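(* Let $p\ge 1$ be an integer and let $z$ be a real number with $0<|z|<1$. Then $$\sum_{n=1}^{\infty} \frac{\zeta(2n+1)z^{2n}}{2n+p+1} = -\frac{1}{2zp} - \frac{\gamma}{p+1} +\sum_{k=0}^{p} \frac{p!\,(-1)^{\lfloor \frac{k+1}{2} \rfloor}\,\pi}{(p-k)!\,(2\pi z)^{k+1}}\,\mathrm{Cl}_{k+1}(2\pi z) - \delta_{\lfloor \frac{p}{2} \rfloor, \frac{p}{2}}\frac{p!\,(-1)^{\frac{p}{2}}\,\pi}{(2\pi z)^{p+1}}\,\zeta(p+1)- \sum_{k=0}^{p} \frac{p!\,(-1)^k\,\psi^{(-k-1)}(z)}{(p-k)!\,z^{k+1}}.$$
   Context: The negapolygammas are $\psi^{(-1)}(z)=\log\Gamma(z)$ and, for $n\ge2$, $\psi^{(-n)}(z)=\frac{1}{(n-2)!}\int_0^z (z-t)^{n-2}\log\Gamma(t)\,dt$; for $t\in(-1,0)$, $\log\Gamma(t)$ is read as $\log|\Gamma(t)|$. The generalized Clausen functions of a real variable $\theta$ are $\mathrm{Cl}_{2j}(\theta)=\sum_{k=1}^\infty \frac{\sin(k\theta)}{k^{2j}}$ for $j\ge1$ and $\mathrm{Cl}_{2j+1}(\theta)=\sum_{k=1}^\infty \frac{\cos(k\theta)}{k^{2j+1}}$ for $j\ge0$; for $\mathrm{Cl}_1$ one takes $\theta\notin 2\pi\mathbb{Z}$, and the series is the conditionally convergent sum. $\zeta$ is the Riemann zeta function and $\gamma$ is the Euler–Mascheroni constant. $\delta_{a,b}$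 is the Kronecker delta, so $\delta_{\lfloor n/2\rfloor,n/2}$ is $1$ if $n$ is even and $0$ if $n$ is odd; a term multiplied by it is read as $0$ when $n$ is odd. *)

(* Defs.v *)
From HB Require Import structures.
From mathcomp Require Import all_boot all_order all_algebra.
From mathcomp Require Import all_classical all_reals all_analysis.

Set Implicit Arguments.
Unset Strict Implicit.
Unset Printing Implicit Defensive.

Import Order.TTheory GRing.Theory Num.Theory.
Import numFieldNormedType.Exports.

Local Open Scope classical_set_scope.
Local Open Scope ring_scope.

(* Junk value (the default point of [limn]) when the series diverges; used for
   s >= 2 only. *)
Definition zeta (R : realType) (s : nat) : R :=
  limn (fun N : nat => \sum_(1 <= k < N) (k%:R ^+ s)^-1 : R).

Definition euler_mascheroni (R : realType) : R :=
  limn (fun N : nat => \sum_(1 <= k < N.+1) (k%:R)^-1 - ln (N%:R : R)).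

(* The limit of the partial sums, not an unordered sum: for m = 1 the series
   is only conditionally convergent. *)
Definition Cl (R : realType) (m : nat) (theta : R) : R :=
  limn (fun N : nat => \sum_(1 <= k < N)
    (if odd m then cos (k%:R * theta) else sin (k%:R * theta)) / k%:R ^+ m).

Definition GammaIntegral (R : realType) (x : R) : R :=
  \int[lebesgue_measure]_(t in `]0, +oo[) (t `^ (x - 1) * expR (- t)).

(* Euler's integral for x > 0, continued to the non-integers x < 0 by
   Gamma x = Gamma (x + n) / (x (x + 1) ... (x + n - 1)) with the least n such
   that 0 < x + n.  The values at the poles 0, -1, -2, ... are junk. *)
Definition Gamma (R : realType) (x : R) : R :=
  let n := if 0 <= x then 0%N else `|Num.floor x|%N in
  GammaIntegral (x + n%:R) / \prod_(i < n) (x + i%:R).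

(* For x > 0 the absolute value is redundant. *)
Definition logGamma (R : realType) (x : R) : R := ln `|Gamma x|.

(* Oriented Lebesgue integral from a to b: the integrand [logGamma] below is
   unbounded near 0. *)
Definition oriented_integral (R : realType) (a b : R) (f : R -> R) : R :=
  if a <= b then \int[lebesgue_measure]_(t in `[a, b]) f t
  else - \int[lebesgue_measure]_(t in `[b, a]) f t.

(* [negapolygamma n] is psi^(-n), meaningful for n >= 1. *)
Definition negapolygamma (R : realType) (n : nat) (z : R) : R :=
  if n is m.+2 then
    (m`!%:R)^-1 * oriented_integral 0 z (fun t => (z - t) ^+ m * logGamma t)
  else logGamma z.

(* Main.v *)
Require Import Defs.
From HB Require Import structures.
From mathcomp Require Import all_boot all_order all_algebra.
From mathcomp Require Import all_classical all_reals all_analysis.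
From mathcomp Require Import measurable_realfun ring lra zify.

Set Implicit Arguments.
Unset Strict Implicit.
Unset Printing Implicit Defensive.

Import Order.TTheory GRing.Theory Num.Theory.
Import numFieldNormedType.Exports.

Local Open Scope classical_set_scope.
Local Open Scope ring_scope.

(** Write f(t) for the sum over n >= 1 of zeta(2n+1) t^(2n+1) / (2n+1).  The
    theorem is the integral of t^p f'(t) from 0 to z, computed in two ways.

    Termwise, z^(p+1) times the series of the theorem is that integral, that
    is, after an integration by parts, z^p f(z) minus the integral of
    p t^(p-1) f(t).  On the other hand f is elementary in terms of log Gamma
    and Cl_1: for 0 < |t| < 1,

      f(t) = - gamma t - log|Gamma(t)| + Cl_1(2 pi t) / 2
             + log(2 pi) / 2 - log|t| / 2.                          (1)

    Integrating p t^(p-1) log|Gamma(t)| yields the negapolygammas, because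
    t^(p-1) expands in powers of z - t; integrating p t^(p-1) Cl_1(2 pi t)
    yields the functions Cl_2, ..., Cl_(p+1), each a primitive of the previous
    one up to sign, and the zeta(p+1) term is the value of Cl_(p+1) at 0; the
    term - 1/(2zp) is what the logarithm log|t| leaves.

    Formula (1) rests on three limits.  Euler's product for Gamma
    ([logGamma_euler]) follows from the functional equation of the integral and
    from Gamma(a + s) <= a^s Gamma(a) for 0 <= s <= 1, a consequence of the
    weighted arithmetic-geometric mean inequality under the integral sign.
    The logarithm of the sine product ([ln_sine_product]) comes from the
    recurrence satisfied by the integrals of cos^n(s) cos(2xs) over
    [0, pi/2].  The Fourier series of - log(2 sin) ([Cl1_uniform]) comes from
    differentiating its partial sums.  The first two express the
    sum over k of artanh(t/k) - t/k through log|Gamma(t)|, gamma and the sine,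
    and expanding artanh turns that sum into f, with a truncation error that is
    uniform in t ([odd_logGamma_series_bound]).

    The integration is carried out on approximations: for every N an
    explicit primitive ([moment_primitive_partial]) of p t^(p-1) times the N-th
    approximation of log|Gamma(t)| is available; it converges uniformly near
    0, while its derivative converges uniformly away from 0.  So its limit
    [moment_primitive] is continuous on ]-1, 1[ and is a primitive of
    p t^(p-1) log|Gamma(t)| off 0.  As log|Gamma| is bounded below, the
    fundamental theorem of calculus applies across the singularity at 0
    ([bounded_below_derivative_integrable], [integrable_derivative_Rintegral]). *)

(** * Pointwise rules of differentiation *)

Section pointwise_derivatives.
Variable R : realType.
Implicit Types (f g : R -> R) (x c df dg : R).

(** These rules restate the library ones for functions given pointwise,
    [fun s => f s + g s], so that derivatives of explicit expressions are
    assembled as terms. *)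
Lemma derD f g x df dg : is_derive x 1 f df -> is_derive x 1 g dg ->
  is_derive x 1 (fun s => f s + g s) (df + dg).
Proof. exact: is_deriveD. Qed.

Lemma derB f g x df dg : is_derive x 1 f df -> is_derive x 1 g dg ->
  is_derive x 1 (fun s => f s - g s) (df - dg).
Proof. exact: is_deriveB. Qed.

Lemma derN f x df : is_derive x 1 f df -> is_derive x 1 (fun s => - f s) (- df).
Proof. exact: is_deriveN. Qed.

Lemma derM f g x df dg : is_derive x 1 f df -> is_derive x 1 g dg ->
  is_derive x 1 (fun s => f s * g s) (df * g x + f x * dg).
Proof.
move=> hf hg; have h := is_deriveM hf hg; apply: is_derive_eq.
by rewrite -![_ *: _]/(_ * _) addrC [g x * _]mulrC.
Qed.

Lemma dercM f x c df : is_derive x 1 f df -> is_derive x 1 (fun s => c * f s) (c * df).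
Proof. exact: is_deriveZ. Qed.

Lemma derX f n x df : is_derive x 1 f df ->
  is_derive x 1 (fun s => f s ^+ n) (n%:R * f x ^+ n.-1 * df).
Proof.
move=> hf; have h := is_deriveX n hf.
rewrite (_ : (fun s => f s ^+ n) = f ^+ n)//; apply/funext => s.
by elim: n {h} => [|n IH]; rewrite ?expr0// !exprS IH.
Qed.

Lemma derV f x df : f x != 0 -> is_derive x 1 f df ->
  is_derive x 1 (fun s => (f s)^-1) (- df / f x ^+ 2).
Proof.
move=> fx0 hf; have E : - (f x) ^- 2 * df = - df / f x ^+ 2 by ring.
exact: (is_derive_eq (is_deriveV fx0 hf) E).
Qed.

Lemma derid x : is_derive x 1 (fun s => s) (1 : R).
Proof. exact: is_derive_id. Qed.

Lemma derpow n x : is_derive x 1 (fun s => s ^+ n) (n%:R * x ^+ n.-1 : R).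
Proof. exact: (is_derive_eq (derX n (derid x)) (mulr1 _)). Qed.

Lemma derlin c x : is_derive x 1 (fun s => c * s) c.
Proof. exact: (is_derive_eq (dercM c (derid x)) (mulr1 _)). Qed.

Lemma dercomp f g x df dg : is_derive x 1 g dg -> is_derive (g x) 1 f df ->
  is_derive x 1 (fun s => f (g s)) (df * dg).
Proof. by move=> hg hf; exact: is_derive1_comp. Qed.

Lemma dersum (u : nat -> R -> R) (du : nat -> R) m n x :
  (forall k, (m <= k < n)%N -> is_derive x 1 (u k) (du k)) ->
  is_derive x 1 (fun s => \sum_(m <= k < n) u k s) (\sum_(m <= k < n) du k).
Proof.
elim: n => [|n IH] h.
  rewrite big_geq// (_ : (fun _ => _) = cst 0); first exact: is_derive_cst.
  by apply/funext => s; rewrite big_geq.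
have [mn|nm] := leqP m n; last first.
  rewrite big_geq// (_ : (fun _ => _) = cst 0); first exact: is_derive_cst.
  by apply/funext => s; rewrite big_geq.
rewrite big_nat_recr//= (_ : (fun _ => _) = fun s => \sum_(m <= k < n) u k s + u n s).
  apply: derD; last by apply: h; rewrite mn ltnSn.
  by apply: IH => k /andP[mk kn]; apply: h; rewrite mk ltnW.
by apply/funext => s; rewrite big_nat_recr.
Qed.

Lemma dersinlin c x : is_derive x 1 (fun s => sin (c * s)) (c * cos (c * x)).
Proof.
exact: (is_derive_eq (dercomp (derlin c x) (is_derive_sin (c * x))) (mulrC _ _)).
Qed.

Lemma dercoslin c x : is_derive x 1 (fun s => cos (c * s)) (- (c * sin (c * x))).
Proof.
have E : - sin (c * x) * c = - (c * sin (c * x)) by ring.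
exact: (is_derive_eq (dercomp (derlin c x) (is_derive_cos (c * x))) E).
Qed.

End pointwise_derivatives.

(** * Uniform limits, their derivatives, and dominated series *)

Section calculus.
Variable R : realType.
Implicit Types (f df g F u v : R -> R) (a b x y C M : R) (e : R^nat).

Lemma derive_continuous f x (l : R) : is_derive x 1 f l -> {for x, continuous f}.
Proof.
by move=> H; apply/differentiable_continuous/derivable1_diffP; apply: ex_derive.
Qed.

Lemma within_oo_continuous f a b : {in `[a, b], continuous f} ->
  {within `[a, b], continuous f}.
Proof.
by move=> cf; apply: continuous_in_subspaceT => x; rewrite inE; exact: cf.
Qed.

(** The mean value theorem; [x] and [y] come in either order. *)
Lemma derive_bounded_lipschitz f df a b C :
  (forall s, a <= s <= b -> is_derive s 1 f (df s)) ->
  (forall s, a <= s <= b -> `|df s| <= C) ->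
  forall x y, a <= x <= b -> a <= y <= b -> `|f y - f x| <= C * `|y - x|.
Proof.
move=> fd dfC.
have main x y : a <= x -> x <= y -> y <= b -> `|f y - f x| <= C * `|y - x|.
  move=> ax xy yb.
  have [s|s|c cxy ->] := @MVT_segment R f df x y xy _ _.
  - rewrite in_itv /= => /andP[xs sy].
    by apply: fd; rewrite (le_trans ax (ltW xs)) (le_trans (ltW sy) yb).
  - move: s; apply: within_oo_continuous => s; rewrite in_itv /= => /andP[xs sy].
    apply: (@derive_continuous _ _ (df s)).
    by apply: fd; rewrite (le_trans ax xs) (le_trans sy yb).
  - rewrite normrM ler_wpM2r//; apply: dfC.
    by move: cxy; rewrite in_itv /= => /andP[xc cy]; rewrite (le_trans ax xc) (le_trans cy yb).
move=> x y /andP[ax xb] /andP[ay yb].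
have [xy|/ltW yx] := leP x y; first exact: main.
by rewrite distrC (distrC y); exact: main.
Qed.

Lemma ball_itv_oo a b x : a < x < b -> \forall s \near x, a < s < b.
Proof.
move=> /andP[ax xb]; near=> s; apply/andP; split.
- by near: s; exact: lt_nbhsr.
- by near: s; exact: lt_nbhsl.
Unshelve. all: by end_near. Qed.

(** Only a bound valid near the point is asked for, since the convergence is
    used on intervals that avoid a singularity. *)
Lemma uniform_limit_continuous_at (U : nat -> R -> R) u a b e x :
  e @ \oo --> 0 -> (forall N s, a < s < b -> `|U N s - u s| <= e N) ->
  a < x < b -> (forall N, {for x, continuous (U N)}) -> {for x, continuous u}.
Proof.
move=> e0 Ue xab cU; apply/cvgrPdist_le => eps eps0.
have e30 : 0 < eps / 3 by rewrite divr_gt0.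
have /cvgrPdist_le /(_ _ e30) [N _ /(_ N (leqnn N))] := e0.
rewrite sub0r normrN => eN.
have Ne : e N <= eps / 3 by rewrite (le_trans (ler_norm _)).
have /cvgrPdist_le /(_ _ e30) := cU N.
move=> H; near=> s.
have h1 : `|U N x - U N s| <= eps / 3 by near: s.
have h2 := Ue N x xab.
have h3 : `|U N s - u s| <= e N by apply: Ue; near: s; exact: ball_itv_oo.
have -> : u x - u s = - (U N x - u x) + (U N x - U N s) + (U N s - u s) by ring.
apply: (le_trans (ler_normD _ _)); apply: (le_trans (lerD (ler_normD _ _) (lexx _))).
rewrite normrN; lra.
Unshelve. all: by end_near. Qed.

Lemma is_derive_of_limit f x (l : R) :
  (h^-1 *: (f (h + x) - f x)) @[h --> 0^'] --> l -> is_derive x 1 f l.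
Proof.
move=> H.
have H' : (fun h => h^-1 *: (f (h *: (1 : R^o) + x) - f x)) @ 0^' --> l.
  apply: cvg_trans H; apply: near_eq_cvg; near=> h.
  by rewrite [h *: _]mulr1.
split; first by apply/cvg_ex; exists l.
exact: cvg_lim H'.
Unshelve. all: by end_near. Qed.

(** Applying the mean value inequality to [U N s - v x * s] bounds
    |U_N(x+h) - U_N(x) - v(x) h| by (eps + e_N) |h|; the limit in N then removes
    e_N. *)
Lemma is_derive_uniform_limit (U dU : nat -> R -> R) u v a b e x :
  e @ \oo --> 0 ->
  (forall N s, a < s < b -> is_derive s 1 (U N) (dU N s)) ->
  (forall N s, a < s < b -> `|dU N s - v s| <= e N) ->
  (forall s, a < s < b -> (U ^~ s) @ \oo --> u s) ->
  a < x < b -> {for x, continuous v} -> is_derive x 1 u (v x).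
Proof.
move=> e0 dUP dUe Uu xab cv; apply: is_derive_of_limit.
apply/cvgrPdist_le => eps eps0.
have e20 : 0 < eps / 2 by rewrite divr_gt0.
have : \forall s \near x, a < s < b /\ `|v x - v s| <= eps / 2.
  near=> s; split; first by near: s; exact: ball_itv_oo.
  by near: s; move/cvgrPdist_le : cv; apply.
move=> /nbhs_ballP [d /= d0 dP].
near=> h.
have h0 : h != 0 by near: h; exact: nbhs_dnbhs_neq.
have hd : `|h| < d.
  near: h; apply: dnbhs0_lt => //.
have sP s : `|s - x| <= `|h| -> a < s < b /\ `|v x - v s| <= eps / 2.
  move=> sh; apply: dP; rewrite /ball /= distrC; exact: le_lt_trans hd.
have key : `|u (h + x) - u x - v x * h| <= eps / 2 * `|h| + 0.
  have lim : (fun N => `|U N (h + x) - U N x - v x * h|) @ \oo --> `|u (h + x) - u x - v x * h|.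
    apply: cvg_norm; apply: cvgB; last exact: cvg_cst.
    apply: cvgB; apply: Uu => //.
    by have := sP (h + x); rewrite addrK lexx => /(_ isT) [].
  have lim2 : (fun N => eps / 2 * `|h| + e N * `|h|) @ \oo --> eps / 2 * `|h| + 0 * `|h|.
    apply: cvgD; first exact: cvg_cst.
    by apply: cvgMl.
  rewrite mul0r in lim2.
  apply: (ler_cvg_to lim lim2); near=> N.
  have := @derive_bounded_lipschitz (fun s => U N s - v x * s) (fun s => dU N s - v x)
    (Num.min x (h + x)) (Num.max x (h+x)) (eps / 2 + e N) _ _ x (h + x).
  have mm s : Num.min x (h + x) <= s <= Num.max x (h + x) -> `|s - x| <= `|h|.
    rewrite minEle maxEle; case: ifP => xh /andP[s1 s2].
      rewrite ger0_norm ?subr_ge0// ger0_norm; lra.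
    rewrite ler0_norm ?subr_le0//.
    have hn : h <= 0 by move/negbT: xh; rewrite -ltNge; lra.
    rewrite ler0_norm; lra.
  have -> : U N (h + x) - v x * (h + x) - (U N x - v x * x) = U N (h + x) - U N x - v x * h by ring.
  rewrite addrK -mulrDl; apply.
  - move=> s /mm/sP[sab _]; have := dUP N s sab => ?.
    by apply: is_derive_eq; rewrite [_%:A]mulr1.
  - move=> s /mm/sP[sab vs]; have := dUe N s sab => h1.
    have -> : dU N s - v x = (dU N s - v s) - (v x - v s) by ring.
    apply: (le_trans (ler_normB _ _)); lra.
  - by rewrite ge_min le_max lexx.
  - by rewrite ge_min le_max lexx !orbT.
have -> : v x - h^-1 *: (u (h + x) - u x) = - (h^-1 * (u (h + x) - u x - v x * h)).
  have -> : h^-1 *: (u (h + x) - u x) = h^-1 * (u (h + x) - u x) :> R by [].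
  by field.
rewrite normrN normrM normfV mulrC ler_pdivrMr ?normr_gt0//.
apply: (le_trans key); rewrite addr0 ler_wpM2r//; lra.
Unshelve. all: by end_near. Qed.

(** The lower bound is [maxn m 1] because the sum up to [m = 0] is empty, as is
    the sum up to 1. *)
Lemma sum1B (w : R^nat) m n : (m <= n)%N ->
  \sum_(1 <= k < n) w k - \sum_(1 <= k < m) w k = \sum_(maxn m 1 <= k < n) w k.
Proof.
case: m => [|m] mn.
  by rewrite (@big_geq _ _ _ 1 0)// subr0.
rewrite (@big_cat_nat _ _ _ m.+1 1 n _ _ isT mn) /= (maxn_idPl _)//; ring.
Qed.

(** The comparison test together with its error bound, which does not depend on
    [w]: this gives uniform convergence when [w] has a parameter. *)
Lemma dominated_series (w M : R^nat) : (forall k, (0 < k)%N -> `|w k| <= M k) ->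
  cvgn (fun N => \sum_(1 <= k < N) M k) ->
  cvgn (fun N => \sum_(1 <= k < N) w k) /\
  forall N, `|\sum_(1 <= k < N) w k - limn (fun N => \sum_(1 <= k < N) w k)|
    <= limn (fun N => \sum_(1 <= k < N) M k) - \sum_(1 <= k < N) M k.
Proof.
move=> wM cM.
have le m n : (m <= n)%N -> `|\sum_(1 <= k < n) w k - \sum_(1 <= k < m) w k| <=
    \sum_(1 <= k < n) M k - \sum_(1 <= k < m) M k.
  move=> mn; rewrite !sum1B//; apply: (le_trans (ler_norm_sum _ _ _)).
  rewrite big_nat_cond [leRHS]big_nat_cond; apply: ler_sum => k /andP[/andP[k1 _] _].
  by apply: wM; move: k1; rewrite geq_max => /andP[].
have cw : cvgn (fun N => \sum_(1 <= k < N) w k).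
  apply: cauchy_cvg; apply: cauchy_exP => eps eps0.
  have e20 : 0 < eps / 3 by rewrite divr_gt0.
  have /cvgrPdist_le /(_ _ e20) [N0 _ HN] := cM.
  exists (\sum_(1 <= k < N0) w k); exists N0 => // n /= Nn.
  rewrite /ball /= distrC; apply: (le_lt_trans (le _ _ Nn)).
  have := HN _ Nn; have := HN _ (leqnn N0); rewrite /= !ler_norml => /andP[h1 h2] /andP[h3 h4].
  lra.
split=> // N.
have l1 : (fun n => `|\sum_(1 <= k < n) w k - \sum_(1 <= k < N) w k|) @ \oo -->
   `|limn (fun N => \sum_(1 <= k < N) w k) - \sum_(1 <= k < N) w k|.
  by apply: cvg_norm; apply: cvgB => //; exact: cvg_cst.
have l2 : (fun n => \sum_(1 <= k < n) M k - \sum_(1 <= k < N) M k) @ \oo -->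
   limn (fun N => \sum_(1 <= k < N) M k) - \sum_(1 <= k < N) M k.
  by apply: cvgB => //; exact: cvg_cst.
rewrite distrC; apply: (ler_cvg_to l1 l2); near=> n; apply: le; near: n.
exact: nbhs_infty_ge.
Unshelve. all: by end_near. Qed.

End calculus.

(** * The fundamental theorem of calculus for singular integrands *)

Section improper_integral.
Variable R : realType.
Local Notation mu := (@lebesgue_measure R).

(** Monotone convergence along an increasing exhaustion by segments. *)
Lemma ge0_integral_exhaustion (g : R -> R) (D : set R) (a b : R^nat) :
  nonincreasing_seq a -> nondecreasing_seq b ->
  D = \bigcup_n `[a n, b n]%classic -> measurable_fun D g ->
  (forall x, D x -> 0 <= g x) ->
  (\int[mu]_(x in `[a n, b n]) (g x)%:E)%E @[n --> \oo]
    --> (\int[mu]_(x in D) (g x)%:E)%E.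
Proof.
move=> na nb DE mg g0; rewrite DE; apply: ge0_nondecreasing_set_cvg_integral => //.
- move=> m n mn; apply/subsetPset => x /=; rewrite !in_itv /= => /andP[h1 h2].
  by rewrite (le_trans (na _ _ mn) h1) (le_trans h2 (nb _ _ mn)).
- move=> i; apply/measurable_EFinP; apply: measurable_funS mg; last first.
    by rewrite DE => x ix; exists i.
  by rewrite DE; exact: bigcup_measurable.
- by move=> i x ix; rewrite lee_fin; apply: g0; rewrite DE; exists i.
Qed.

Lemma oo_measurable (g : R -> R) (a b : R) :
  {in `]a, b[, continuous g} -> measurable_fun `]a, b[ g.
Proof.
by move=> cg; apply: open_continuous_measurable_fun => // x; rewrite inE; exact: cg.
Qed.

(** Adding [M] makes the integrand nonnegative; its integrals over the segments
    [a + d_n, b - d_n] are increments of [F x + M x], which stay bounded since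
    [F] is continuous up to the endpoints, where [g] may be unbounded. *)
Lemma bounded_below_derivative_integrable (F g : R -> R) (a b M : R) : a < b ->
  {within `[a, b], continuous F} ->
  (forall x, a < x < b -> is_derive x 1 F (g x)) ->
  {in `]a, b[, continuous g} ->
  (forall x, a < x < b -> - M <= g x) ->
  mu.-integrable `[a, b] (EFin \o g).
Proof.
move=> ab cF dF cg gM.
have mg : measurable_fun `]a, b[ g by exact: oo_measurable.
pose h x := g x + M.
have mh : measurable_fun `]a, b[ h by exact: measurable_funD.
have h0 x : `]a, b[%classic x -> 0 <= h x.
  by rewrite /= in_itv /= => /gM; rewrite /h; lra.
pose d n : R := (b - a) / n.+3%:R.
have d0 n : 0 < d n by rewrite divr_gt0// subr_gt0.
have dab n : a + d n < b - d n.
  have n3 : (3 : R) <= n.+3%:R by rewrite ler_nat.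
  have : (b - a) / n.+3%:R <= (b - a) / 3.
    by rewrite ler_pM2l ?subr_gt0// lef_pV2// posrE.
  rewrite -/(d n); lra.
have dni : nonincreasing_seq d.
  move=> m n mn; rewrite /d ler_pM2l ?subr_gt0// lef_pV2 ?posrE//.
  by rewrite ler_nat !ltnS.
have dc : d @ \oo --> 0.
  rewrite -(mulr0 (b - a)); apply: cvgMr.
  have := @cvg_harmonic R; rewrite -(cvg_shiftn 2) /=.
  by under eq_cvg do rewrite addn2.
have Dex : `]a, b[%classic = \bigcup_n `[a + d n, b - d n]%classic.
  apply/seteqP; split=> [x|x [n _]] /=; rewrite !in_itv /=; last first.
    have := d0 n; move=> ? /andP[? ?]; apply/andP; split; lra.
  move=> /andP[ax xb].
  have e0 : 0 < Num.min (x - a) (b - x) by rewrite lt_min !subr_gt0 ax.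
  have /cvgrPdist_le /(_ _ e0) [N _ /(_ N (leqnn N))] := dc.
  rewrite sub0r normrN ger0_norm ?(ltW (d0 _))// le_min => /andP[h1 h2].
  exists N => //=; rewrite in_itv /=; apply/andP; split; lra.
have lim1 : (\int[mu]_(x in `[(a + d n)%R, (b - d n)%R]) (h x)%:E)%E @[n --> \oo]
    --> (\int[mu]_(x in `]a, b[) (h x)%:E)%E.
  apply: (@ge0_integral_exhaustion _ _ (fun n => a + d n) (fun n => b - d n)) => //.
  - by move=> m n /dni; rewrite lerD2l.
  - by move=> m n /dni; rewrite lerD2l lerN2.
have val n : (\int[mu]_(x in `[(a + d n)%R, (b - d n)%R]) (h x)%:E =
   ((F (b - d n) + M * (b - d n)) - (F (a + d n) + M * (a + d n)))%:E)%E.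
  pose G x := F x + M * x.
  have dG x : a < x < b -> is_derive x 1 G (h x).
    move=> xab; have := dF x xab => ?; apply: is_derive_eq.
    by rewrite [_%:A]mulr1.
  have sub x : a + d n <= x <= b - d n -> a < x < b.
    have := d0 n; move=> ? /andP[? ?]; apply/andP; split; lra.
  rewrite (@continuous_FTC2 _ h G)//.
  - apply: within_oo_continuous => x; rewrite in_itv /= => /sub xab.
    by apply: cvgD; [apply: cg; rewrite in_itv|exact: cvg_cst].
  - have cG x : a + d n <= x <= b - d n -> {for x, continuous G}.
      by move=> /sub/dG; exact: derive_continuous.
    split.
    + move=> x; rewrite in_itv /= => /andP[h1 h2].
      have : a < x < b by apply: sub; rewrite !ltW.
      by move=> /dG ?; exact: ex_derive.
    + by apply: cvg_at_right_filter; apply: cG; rewrite lexx ltW.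
    + by apply: cvg_at_left_filter; apply: cG; rewrite lexx ltW.
  - move=> x; rewrite in_itv /= => /andP[h1 h2].
    have : a < x < b by apply: sub; rewrite !ltW.
    by move=> /dG ?; rewrite derive1E derive_val.
have [_ Fa Fb] := (continuous_within_itvP _ ab).1 cF.
have Fan : F (a + d n) @[n --> \oo] --> F a.
  apply: (cvg_at_rightP _ _ _).1 Fa _ _; split=> [n|]; first by rewrite ltrDl.
  by rewrite -[X in _ --> X]addr0; apply: cvgD => //; exact: cvg_cst.
have Fbn : F (b - d n) @[n --> \oo] --> F b.
  apply: (cvg_at_leftP _ _ _).1 Fb _ _; split=> [n|]; first by rewrite gtrBl.
  by rewrite -[X in _ --> X]subr0; apply: cvgB => //; exact: cvg_cst.
have Ih : (\int[mu]_(x in `]a, b[) (h x)%:E =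
    ((F b + M * b) - (F a + M * a))%:E)%E.
  apply: (cvg_unique (@ereal_hausdorff R) lim1).
  rewrite (_ : (fun n => _) = EFin \o (fun n => F (b - d n) + M * (b - d n)
    - (F (a + d n) + M * (a + d n)))); last by apply/funext => n; exact: val.
  apply: cvg_EFin; first exact: nearW.
  have bn : b - d n @[n --> \oo] --> b.
    by rewrite -[X in _ --> X]subr0; apply: cvgB => //; exact: cvg_cst.
  have an : a + d n @[n --> \oo] --> a.
    by rewrite -[X in _ --> X]addr0; apply: cvgD => //; exact: cvg_cst.
  by apply: cvgB; apply: cvgD => //; exact: cvgMr.
have ih : mu.-integrable `]a, b[ (EFin \o h).
  apply/integrableP; split; first exact/measurable_EFinP.
  under eq_integral => x do [rewrite inE => /h0 hx /=; rewrite ger0_norm//].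
  by rewrite Ih ltry.
have ig : mu.-integrable `]a, b[ (EFin \o g).
  have iM : mu.-integrable `]a, b[ (EFin \o cst M).
    apply: measurable_bounded_integrable => //.
    - have muy : (lebesgue_measure (`]a, b[%classic : set R) < +oo)%E.
        by rewrite lebesgue_measure_itv /= lte_fin ab -EFinD ltry.
      exact: muy.
    - by exists `|M|; split => // x Mx y _; exact: ltW.
  have ihM : mu.-integrable `]a, b[ ((EFin \o h) \- (EFin \o cst M))%E.
    by apply: integrableB.
  apply: (eq_integrable _ _ _ _ ihM) => // x _.
  by rewrite /= /h; congr (_%:E); ring.
have /integrableP[_ gy] := ig.
apply/integrableP; split.
  by apply/measurable_EFinP; exact: measurable_fun_itv_cc mg.
rewrite integral_itv_bndoo//.
by apply/measurable_EFinP; apply: measurableT_comp.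
Qed.

(** The integral of [g] up to [x] is continuous on the closed segment because [g]
    is integrable, and has the derivative of [F] inside; so the two differ by a
    constant. *)
Lemma integrable_derivative_Rintegral (F g : R -> R) (a b : R) : a <= b ->
  {within `[a, b], continuous F} ->
  (forall x, a < x < b -> is_derive x 1 F (g x)) ->
  {in `]a, b[, continuous g} ->
  mu.-integrable `[a, b] (EFin \o g) ->
  \int[mu]_(x in `[a, b]) g x = F b - F a.
Proof.
rewrite le_eqVlt => /predU1P[<-|ab].
  by rewrite subrr set_itv1 Rintegral_set1.
move=> cF dF cg ig.
pose P x := \int[mu]_(t in `[a, x]) g t.
have cP : {within `[a, b], continuous P}.
  exact: (parameterized_integral_continuous (ltW ab) ig).
have dP x : a < x < b -> is_derive x 1 P (g x).
  move=> /andP[ax xb].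
  have cx : {for x, continuous g} by apply: cg; rewrite in_itv /= ax.
  have [dPx] := continuous_FTC1_closed xb ig ax cx.
  by rewrite derive1E => Px; split.
have [x|x|x _] := @MVT R (P \- F) (cst 0) a b ab _ _.
- rewrite in_itv /= => xab; have := dP x xab; have := dF x xab => ? ?.
  by apply: is_derive_eq; rewrite subrr.
- by apply: cvgB; [exact: cP|exact: cF].
rewrite /= mul0r /P set_itv1 Rintegral_set1 sub0r opprK -/(P b) => ?; lra.
Qed.

End improper_integral.

(** * Euler's integral *)

Section gamma.
Variable R : realType.
Local Notation mu := (@lebesgue_measure R).
Implicit Types (x t s a : R).

Definition gamma_integrand x t : R := t `^ (x - 1) * expR (- t).

(** Euler's integral is kept in the extended reals until it is known to be
    finite: the functional equation and the inequality below hold there, and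
    together they prove finiteness. *)
Definition eGamma x : \bar R :=
  (\int[mu]_(t in `]0%R, +oo[) (gamma_integrand x t)%:E)%E.

Lemma gamma_integrand_ge0 x t : 0 <= gamma_integrand x t.
Proof. by rewrite mulr_ge0 ?powR_ge0 ?expR_ge0. Qed.

Lemma is_derive_expRN t : is_derive t 1 (fun u : R => expR (- u)) (- expR (- t)).
Proof.
by apply: is_derive_eq; rewrite mulrN1.
Qed.

Lemma continuous_expRN : continuous (fun u : R => expR (- u)).
Proof. by move=> t; exact: derive_continuous (is_derive_expRN t). Qed.

Lemma gamma_integrand_continuous x t : 0 < t -> {for t, continuous (gamma_integrand x)}.
Proof.
move=> t0; apply: cvgM; last exact: continuous_expRN.
exact: derive_continuous (is_derive1_powR (x - 1) t0).
Qed.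

Lemma gamma_integrand_measurable x : measurable_fun `](0 : R), +oo[ (gamma_integrand x).
Proof.
apply: open_continuous_measurable_fun => // t; rewrite inE /= in_itv /= andbT.
exact: gamma_integrand_continuous.
Qed.

Lemma eGamma1 : eGamma 1 = 1%E.
Proof.
rewrite /eGamma integral_itv_obnd_cbnd; last first.
  by apply/measurable_EFinP; exact: gamma_integrand_measurable.
under eq_integral do rewrite /gamma_integrand subrr powRr0 mul1r.
rewrite (@ge0_continuous_FTC2y R _ (fun u => - expR (- u)) 0 0).
- by rewrite oppr0 expR0 -EFinN opprK -EFinD add0r.
- by move=> t _; exact: expR_ge0.
- by apply: continuous_subspaceT => t; exact: continuous_expRN.
- by rewrite -oppr0; apply: cvgN; exact: cvgr_expR.
- by move=> t _; have := is_derive_expRN t => ?; exact: derivableN.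
- by apply: cvg_at_right_filter; apply: cvgN; exact: continuous_expRN.
- move=> t _; have := is_derive_expRN t => ?.
  by rewrite derive1E derive_val opprK.
Qed.

Lemma powR_expRN_cvg0 x : x >= 0 -> (fun n => n.+1%:R `^ x * expR (- n.+1%:R)) @ \oo --> (0 : R).
Proof.
move=> x0; pose m := (Num.truncn x).+1.
have xm : x <= m%:R by exact: ltW (truncnS_gt x).
apply: (@squeeze_cvgr _ _ _ _ (cst 0) (fun n => m.+1`!%:R * harmonic n)); last 2 first.
- exact: cvg_cst.
- by rewrite -(mulr0 m.+1`!%:R); apply: cvgMr; exact: cvg_harmonic.
near=> n; rewrite mulr_ge0 ?powR_ge0 ?expR_ge0//=.
have n1 : (1 : R) <= n.+1%:R by rewrite ler1n.
apply: (@le_trans _ _ (n.+1%:R ^+ m * expR (- n.+1%:R))).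
  by rewrite ler_pM2r ?expR_gt0// -powR_mulrn// ler_powR.
have := @expR_ge1Dxn R n.+1%:R m (ler0n _ _).
rewrite expRN ler_pdivrMr ?expR_gt0// => h.
rewrite mulrAC ler_pdivlMr ?ltr0n// -exprSr.
have : n.+1%:R ^+ m.+1 / m.+1`!%:R <= expR (n.+1%:R : R) by lra.
by rewrite ler_pdivrMr ?ltr0n ?fact_gt0// mulrC.
Unshelve. all: by end_near. Qed.

Lemma eGamma_ge0 x : (0 <= eGamma x)%E.
Proof. by apply: integral_ge0 => t _; rewrite lee_fin gamma_integrand_ge0. Qed.

Lemma pos_itv_exhaust : `]0, +oo[%classic = \bigcup_n `[harmonic n : R, n.+1%:R]%classic.
Proof.
apply/seteqP; split=> [t|t [n _]] /=; rewrite !in_itv /= ?andbT; last first.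
  by move=> /andP[h _]; exact: lt_le_trans h.
move=> t0.
have /cvgrPdist_le /(_ _ t0) [N _ HN] := @cvg_harmonic R.
pose n := (N + Num.truncn t)%N.
exists n => //=; rewrite in_itv /=; apply/andP; split.
  have := HN n; rewrite sub0r normrN ger0_norm ?harmonic_ge0 //=; apply.
  exact: leq_addr.
apply: (le_trans (ltW (truncnS_gt t))).
by rewrite ler_nat ltnS leq_addl.
Qed.

(** Integration by parts on the segments [1/(n+1), n+1]; the boundary terms
    t^x exp(-t) vanish at both ends in the limit. *)
Lemma eGammaD1 x : 0 < x -> eGamma (x + 1) = (x%:E * eGamma x)%E.
Proof.
move=> x0.
have ex y : (\int[mu]_(t in `[harmonic n, n.+1%:R]) (gamma_integrand y t)%:E)%E
    @[n --> \oo] --> eGamma y.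
  apply: ge0_integral_exhaustion.
  - by move=> m n mn /=; rewrite lef_pV2 ?posrE// ler_nat ltnS.
  - by move=> m n mn /=; rewrite ler_nat ltnS.
  - exact: pos_itv_exhaust.
  - exact: gamma_integrand_measurable.
  - by move=> t _; exact: gamma_integrand_ge0.
pose F (t : R) := t `^ x * expR (- t).
have ci y n : mu.-integrable `[harmonic n, n.+1%:R] (EFin \o gamma_integrand y).
  apply: continuous_compact_integrable; first exact: segment_compact.
  apply: within_oo_continuous => t; rewrite in_itv /= => /andP[h _].
  by apply: gamma_integrand_continuous; exact: lt_le_trans h.
pose J y n := \int[mu]_(t in `[harmonic n, n.+1%:R]) gamma_integrand y t.
have JE y n : (\int[mu]_(t in `[harmonic n, n.+1%:R]) (gamma_integrand y t)%:E)%E = (J y n)%:E.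
  by rewrite /J /Rintegral fineK//; apply: integrable_fin_num => //; exact: ci.
have key n : J (x + 1) n = x * J x n - (F n.+1%:R - F (harmonic n)).
  have dF t : 0 < t -> is_derive t 1 F (x * gamma_integrand x t - gamma_integrand (x + 1) t).
    move=> t0; have := is_derive1_powR x t0; have := is_derive_expRN t => ? ?.
    apply: is_derive_eq; rewrite /gamma_integrand addrK -![_ *: _]/(_ * _); ring.
  have sub t : t \in `[harmonic n : R, n.+1%:R] -> 0 < t.
    by rewrite in_itv /= => /andP[h _]; exact: lt_le_trans h.
  have le1 : harmonic n <= n.+1%:R :> R.
    by apply: (@le_trans _ _ 1); rewrite ?ler1n//= invf_le1 ?ltr0n// ler1n.
  have ixh : mu.-integrable `[harmonic n, n.+1%:R]
      (EFin \o (fun t => x * gamma_integrand x t)).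
    by apply: (eq_integrable _ _ _ _ (integrableZl _ x (ci x n))).
  have <- : \int[mu]_(t in `[harmonic n, n.+1%:R])
      (x * gamma_integrand x t - gamma_integrand (x + 1) t) = F n.+1%:R - F (harmonic n).
    apply: integrable_derivative_Rintegral => //.
    - by apply: within_oo_continuous => t /sub/dF; exact: derive_continuous.
    - by move=> t /andP[h1 h2]; apply/dF/sub; rewrite in_itv /= !ltW.
    - move=> t ht; have t0 : 0 < t by apply: sub; exact: subset_itv_oo_cc ht.
      apply: cvgB; last exact: gamma_integrand_continuous.
      by apply: cvgMr; exact: gamma_integrand_continuous.
    - by apply: (eq_integrable _ _ _ _ (integrableB _ ixh (ci (x + 1) n))).
  by rewrite RintegralB// RintegralZl// -/(J x n) -/(J (x + 1) n); ring.
have F0 : F n.+1%:R - F (harmonic n) @[n --> \oo] --> 0.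
  rewrite -(subr0 0); apply: cvgB; first exact: powR_expRN_cvg0 (ltW x0).
  rewrite -(mul0r 1); apply: cvgM.
    apply: (cvg_at_rightP _ _ _).1 (powR_cvg0 x0) (@harmonic R) _; split => [n|].
      exact: harmonic_gt0.
    exact: (@cvg_harmonic R).
  have := @continuous_expRN 0; rewrite /continuous_at oppr0 expR0 => h.
  exact: (cvg_comp (@harmonic R) (fun u => expR (- u)) cvg_harmonic h).
have l1 := ex (x + 1).
have l2 : (x%:E * (J x n)%:E + (- (F n.+1%:R - F (harmonic n)))%:E)%E @[n --> \oo]
    --> (x%:E * eGamma x + 0)%E.
  apply: cvgeD; first by rewrite fin_num_adde_defl.
    apply: cvgeZl => //; have := ex x.
    by under eq_fun do rewrite JE.
  apply: cvg_EFin; first exact: nearW.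
  by rewrite -oppr0; exact: cvgN.
rewrite adde0 in l2; apply: (cvg_unique (@ereal_hausdorff R) l1).
rewrite (_ : (fun n => _) = (fun n => (x%:E * (J x n)%:E + (- (F n.+1%:R - F (harmonic n)))%:E)%E))//.
by apply/funext => n; rewrite JE key.
Qed.

(** With L = ln y this is the convexity of exp, obtained from the tangent at
    s L evaluated at L and at 0. *)
Lemma weighted_AMGM (y s : R) : 0 < y -> 0 <= s <= 1 -> y `^ s <= 1 - s + s * y.
Proof.
move=> y0 /andP[s0 s1]; rewrite /powR gt_eqF//; set L := ln y.
have -> : y = expR L by rewrite lnK.
have h1 : expR (s * L) * (1 + (1 - s) * L) <= expR L.
  have -> : expR L = expR (s * L) * expR ((1 - s) * L).
    by rewrite -expRD; congr expR; ring.
  by rewrite ler_pM2l ?expR_gt0// expR_ge1Dx.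
have h2 : expR (s * L) * (1 + - (s * L)) <= 1.
  rewrite -[leRHS](expRxMexpNx_1 (s * L)).
  by rewrite ler_pM2l ?expR_gt0// expR_ge1Dx.
have h3 : s * (expR (s * L) * (1 + (1 - s) * L)) <= s * expR L by rewrite ler_wpM2l.
have h4 : (1 - s) * (expR (s * L) * (1 + - (s * L))) <= (1 - s) * 1.
  by rewrite ler_wpM2l// subr_ge0.
have -> : expR (s * L) = s * (expR (s * L) * (1 + (1 - s) * L)) +
  (1 - s) * (expR (s * L) * (1 + - (s * L))) by ring.
lra.
Qed.

(** A form of the log-convexity of Gamma, proved under the integral sign:
    there, t^s <= a^s (1 - s + s t / a), and the functional equation turns
    the integral of the right-hand side into a^s times Gamma(a). *)
Lemma eGammaD_le a s : 0 < a -> 0 <= s <= 1 -> (eGamma (a + s) <= (a `^ s)%:E * eGamma a)%E.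
Proof.
move=> a0 s01; have /andP[s0 s1] := s01.
have step : (eGamma (a + s) <= \int[mu]_(t in `]0%R, +oo[)
    ((a `^ s * (1 - s))%:E * (gamma_integrand a t)%:E
     + (a `^ s * s / a)%:E * (gamma_integrand (a + 1) t)%:E))%E.
  apply: ge0_le_integral => //.
  - by move=> t _; rewrite lee_fin gamma_integrand_ge0.
  - by apply/measurable_EFinP; exact: gamma_integrand_measurable.
  - by apply: emeasurable_funD; apply: measurable_funeM;
      apply/measurable_EFinP; exact: gamma_integrand_measurable.
  move=> t; rewrite /= in_itv /= andbT => t0.
  rewrite -!EFinM -EFinD lee_fin /gamma_integrand !mulrA -mulrDl ler_pM2r ?expR_gt0//.
  have tne : t != 0 by rewrite gt_eqF.
  rewrite addrK.
  have -> : t `^ (a + s - 1) = t `^ (a - 1) * t `^ s.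
    by rewrite -powRD ?tne ?implybT//; congr (_ `^ _); ring.
  rewrite -(mulr_powRB1 (ltW t0) a0).
  have -> : t `^ s = a `^ s * (t / a) `^ s.
    rewrite -powRM ?ltW ?divr_gt0//; congr (_ `^ _); field; exact: lt0r_neq0.
  have h := @weighted_AMGM (t / a) s (divr_gt0 t0 a0) s01.
  have p1 : 0 < t `^ (a - 1) * a `^ s by rewrite mulr_gt0// powR_gt0.
  rewrite -(ler_pM2l p1) in h; rewrite mulrA.
  apply: (le_trans h); rewrite le_eqVlt; apply/orP; left; apply/eqP.
  by field; exact: lt0r_neq0.
have as0 : 0 <= a `^ s by exact: powR_ge0.
apply: (le_trans step).
rewrite ge0_integralD//=; last 4 first.
- move=> t _; rewrite -EFinM lee_fin; apply: mulr_ge0 (gamma_integrand_ge0 _ _).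
  by apply: mulr_ge0 => //; rewrite subr_ge0.
- by apply: measurable_funeM; apply/measurable_EFinP; exact: gamma_integrand_measurable.
- move=> t _; rewrite -EFinM lee_fin; apply: mulr_ge0 (gamma_integrand_ge0 _ _).
  by apply: divr_ge0; [exact: mulr_ge0|exact: ltW].
- by apply: measurable_funeM; apply/measurable_EFinP; exact: gamma_integrand_measurable.
rewrite !ge0_integralZl_EFin//=; last 6 first.
- by move=> t _; rewrite lee_fin gamma_integrand_ge0.
- by apply/measurable_EFinP; exact: gamma_integrand_measurable.
- by rewrite divr_ge0 ?mulr_ge0// ltW.
- by move=> t _; rewrite lee_fin gamma_integrand_ge0.
- by apply/measurable_EFinP; exact: gamma_integrand_measurable.
- by rewrite mulr_ge0// subr_ge0.
rewrite -/(eGamma a) -/(eGamma (a + 1)) eGammaD1// muleA -EFinM.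
rewrite -ge0_muleDl ?lee_fin ?mulr_ge0 ?subr_ge0 ?invr_ge0 ?(ltW a0)//.
rewrite -EFinD [X in X%:E](_ : _ = a `^ s)//.
by field; exact: lt0r_neq0.
Qed.

End gamma.

(** * Euler's product for the Gamma function *)

Section euler_limit.
Variable R : realType.
Implicit Types (x t s a : R).

Lemma ln_prod (f : nat -> R) n : (forall k, (1 <= k)%N -> 0 < f k) ->
  ln (\prod_(1 <= k < n.+1) f k) = \sum_(1 <= k < n.+1) ln (f k).
Proof.
move=> f0; elim: n => [|n IH]; first by rewrite !big_geq// ln1.
rewrite !(@big_nat_recr _ _ _ n.+1 1)//= lnM ?IH// ?posrE ?f0//.
by rewrite big_nat_cond; apply: prodr_gt0 => k /andP[/andP[k1 _] _]; exact: f0.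
Qed.

(** On ]0, 1] finiteness of Gamma(y) follows from y Gamma(y) = Gamma(y + 1) <=
    Gamma(1); the functional equation then climbs. *)
Lemma eGamma_fin x : 0 < x -> eGamma x \is a fin_num.
Proof.
have main n : forall y : R, 0 < y -> y <= n.+1%:R -> eGamma y \is a fin_num.
  elim: n => [|n IH] y y0 yn.
    have := @eGammaD_le R 1 y ltr01; rewrite (ltW y0) yn => /(_ isT).
    rewrite addrC eGammaD1// powR1 eGamma1 mule1.
    have := eGamma_ge0 y; case: (eGamma y) => // _.
    by rewrite gt0_muley ?lte_fin// leye_eq.
  have [|yn1] := leP y n.+1%:R; first exact: IH.
  have y1 : 0 < y - 1 by rewrite subr_gt0 (le_lt_trans _ yn1)// ler1n.
  rewrite -(subrK 1 y) eGammaD1// fin_numM// IH//.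
  by rewrite lerBlDr natr1.
by move=> x0; apply: (main (Num.truncn x)) => //; exact: ltW (truncnS_gt x).
Qed.

Lemma GammaIntegralE x : 0 < x -> (GammaIntegral x)%:E = eGamma x.
Proof. by move=> x0; rewrite /GammaIntegral /Rintegral fineK// eGamma_fin. Qed.

Lemma GammaIntegralD1 x : 0 < x -> GammaIntegral (x + 1) = x * GammaIntegral x.
Proof.
move=> x0; apply: EFin_inj.
by rewrite EFinM !GammaIntegralE ?addr_gt0// eGammaD1.
Qed.

Lemma GammaIntegral_fact n : GammaIntegral (n.+1%:R : R) = n`!%:R.
Proof.
elim: n => [|n IH]; first by apply: EFin_inj; rewrite GammaIntegralE// eGamma1.
by rewrite -natr1 GammaIntegralD1// IH factS natrM.
Qed.

Lemma GammaIntegralD_le a s : 0 < a -> 0 <= s <= 1 ->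
  GammaIntegral (a + s) <= a `^ s * GammaIntegral a.
Proof.
move=> a0 s01; rewrite -lee_fin EFinM !GammaIntegralE//; first exact: eGammaD_le.
by case/andP: s01 => s0 _; rewrite ltr_wpDr.
Qed.

Lemma GammaIntegral_prod x n : 0 < x ->
  GammaIntegral (x + n%:R) = (\prod_(i < n) (x + i%:R)) * GammaIntegral x.
Proof.
move=> x0; elim: n => [|n IH]; first by rewrite addr0 big_ord0 mul1r.
have xn : 0 < x + n%:R by rewrite ltr_wpDr.
by rewrite -natr1 addrA GammaIntegralD1// IH big_ord_recr /= mulrA [_ * (x + n%:R)]mulrC.
Qed.

(** Gamma(n+1+t) is about n! n^t.  The two bounds are
    instances of Gamma(a + s) <= a^s Gamma(a): for t >= 0 take a = n+1 and
    a = n+t, for t < 0 take a = n and a = n+1+t. *)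
Lemma ln_GammaIntegral_asymptotics n t : (0 < n)%N -> `|t| < 1 ->
  0 < GammaIntegral (n.+1%:R + t) /\
  `|ln (GammaIntegral (n.+1%:R + t)) - ln n`!%:R - t * ln n%:R| <= ln n.+1%:R - ln n%:R.
Proof.
move=> n0; rewrite ltr_norml => /andP[tN1 t1].
have nR0 : (0 : R) < n%:R by rewrite ltr0n.
have n1 : (1 : R) <= n%:R by rewrite ler1n.
have nt0 : 0 < n%:R + t by lra.
have f0 : (0 : R) < n`!%:R by rewrite ltr0n fact_gt0.
have ln1n : ln n%:R <= ln n.+1%:R :> R by rewrite ler_ln ?posrE ?ltr0n// ler_nat.
set G := GammaIntegral (n.+1%:R + t).
have fromb b c : 0 < b -> b * n`!%:R <= G -> G <= c * n`!%:R ->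
   0 < G /\ ln b <= ln G - ln n`!%:R <= ln c.
  move=> b0 h1 h2.
  have G0 : 0 < G by apply: lt_le_trans h1; rewrite mulr_gt0.
  have c0 : 0 < c by rewrite -(pmulr_lgt0 _ f0); exact: lt_le_trans h2.
  split => //; rewrite lerBrDr lerBlDr -!lnM ?posrE//.
  by rewrite !ler_ln ?posrE ?mulr_gt0// h1 h2.
have [t0|t0] := leP 0 t.
  have h1 : n%:R `^ t * n`!%:R <= G.
    apply: (@le_trans _ _ ((n%:R + t) `^ t * n`!%:R)).
      by rewrite ler_pM2r//; apply: ge0_ler_powR; rewrite ?nnegrE; lra.
    have := @GammaIntegralD_le (n%:R + t) (1 - t) nt0.
    rewrite subr_ge0 (ltW t1) gerBl t0 => /(_ isT).
    rewrite (_ : n%:R + t + (1 - t) = n.+1%:R); last by rewrite -natr1; ring.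
    rewrite GammaIntegral_fact => h.
    have p0 : 0 < (n%:R + t) `^ t by rewrite powR_gt0.
    rewrite -(ler_pM2l p0) in h; apply: (le_trans h).
    have e1 : t + (1 - t) = 1 by ring.
    have pe : (t + (1 - t) == 0) ==> (n%:R + t != 0) by rewrite (gt_eqF nt0) implybT.
    rewrite mulrA -powRD// e1 powRr1; last exact: ltW.
    by rewrite -GammaIntegralD1// /G -natr1 addrAC.
  have h2 : G <= n.+1%:R `^ t * n`!%:R.
    by rewrite -GammaIntegral_fact; apply: GammaIntegralD_le; rewrite ?ltr0n// t0 ltW.
  have [G0] := fromb _ _ (powR_gt0 t nR0) h1 h2.
  rewrite !ln_powR => /andP[h3 h4]; split => //.
  have : t * (ln n.+1%:R - ln n%:R) <= ln n.+1%:R - ln n%:R.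
    by rewrite ler_piMl ?subr_ge0// ltW.
  move=> h5; rewrite ger0_norm; lra.
have h1 : n.+1%:R `^ t * n`!%:R <= G.
  have a0 : 0 < n.+1%:R + t by rewrite -natr1; lra.
  have := @GammaIntegralD_le (n.+1%:R + t) (- t) a0.
  rewrite addrK oppr_ge0 (ltW t0) lerNl (ltW tN1) => /(_ isT).
  rewrite GammaIntegral_fact -/G => h.
  have h' : n`!%:R <= n.+1%:R `^ (- t) * G.
    apply: (le_trans h); rewrite ler_wpM2r//.
      have : 0 < (n.+1%:R + t) `^ (- t) * G by exact: lt_le_trans h.
      by rewrite pmulr_rgt0 ?powR_gt0// => /ltW.
    by apply: ge0_ler_powR; rewrite ?nnegrE; lra.
  have p0 : 0 < n.+1%:R `^ t :> R by rewrite powR_gt0// ltr0n.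
  rewrite -(ler_pM2l p0) in h'; apply: (le_trans h').
  by rewrite powRN mulrA divff ?gt_eqF// mul1r.
have h2 : G <= n%:R `^ t * n`!%:R.
  rewrite /G (_ : n.+1%:R + t = n%:R + (1 + t)); last by rewrite -natr1; ring.
  apply: (le_trans (GammaIntegralD_le _ _)) => //; first by apply/andP; split; lra.
  rewrite -{2}(prednK n0) GammaIntegral_fact.
  have pe : (1 + t == 0) ==> (n%:R != 0 :> R) by rewrite (gt_eqF nR0) implybT.
  rewrite powRD// powRr1; last exact: ltW.
  rewrite mulrAC -natrM.
  have -> : (n * n.-1`!)%N = n`! by rewrite -[in RHS](prednK n0) factS prednK.
  by rewrite mulrC.
have [G0] := fromb _ _ (powR_gt0 t (ltr0Sn R n)) h1 h2.
rewrite !ln_powR => /andP[h3 h4]; split => //.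
have : - t * (ln n.+1%:R - ln n%:R) <= ln n.+1%:R - ln n%:R.
  by rewrite ler_piMl ?subr_ge0//; lra.
move=> h5; rewrite ler0_norm; lra.
Qed.

(** For t in ]0, 1[ no shift occurs in the definition of Gamma, for t in ]-1, 0[
    there is one; multiplying by |t| makes the two cases agree. *)
Lemma Gamma_prod n t : 0 < `|t| < 1 ->
  `|Gamma t| * `|t| * \prod_(1 <= k < n.+1) (k%:R + t) = `|GammaIntegral (n.+1%:R + t)|.
Proof.
rewrite normr_gt0 => /andP[t0]; rewrite ltr_norml => /andP[tN1 t1].
have pr y : \prod_(i < n) (y + 1 + i%:R) = \prod_(1 <= k < n.+1) (k%:R + y) :> R.
  rewrite big_add1 /= big_mkord; apply: eq_bigr => i _.
  by rewrite -natr1; ring.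
have prge : 0 <= \prod_(1 <= k < n.+1) (k%:R + t).
  rewrite big_nat_cond; apply: prodr_ge0 => k /andP[/andP[k1 _] _].
  have : (1 : R) <= k%:R by rewrite ler1n.
  lra.
have t10 : 0 < t + 1 by lra.
have -> : `|Gamma t| * `|t| = `|GammaIntegral (t + 1)|.
  rewrite -(normrM (Gamma t)) /Gamma; case: (leP 0 t) => [tge|tlt].
    rewrite addr0 big_ord0 divr1 mulrC GammaIntegralD1//.
    by rewrite lt_neqAle eq_sym t0.
  have -> : Num.floor t = -1.
    by apply: floor_def; rewrite addNr mulrN1z (ltW tN1).
  have -> : absz (-1)%R = 1%N by [].
  by rewrite big_ord_recl big_ord0 addr0 mulr1 divfK.
have -> : n.+1%:R + t = t + 1 + n%:R by rewrite -natr1; ring.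
by rewrite GammaIntegral_prod// pr mulrC normrM (ger0_norm prge).
Qed.

(** Euler's limit formula.  The difference of the two sides is
    ln Gamma(n+1+t) - ln n! - t ln n, which the previous bounds make smaller than
    ln(1 + 1/n). *)
Lemma logGamma_euler t : 0 < `|t| < 1 ->
  (fun n => t * ln n%:R - \sum_(1 <= k < n.+1) ln (1 + t / k%:R)) @ \oo -->
    logGamma t + ln `|t|.
Proof.
move=> t01; have /andP[t0 t1] := t01; rewrite normr_gt0 in t0.
have t1' := t1; rewrite ltr_norml in t1'; case/andP: t1' => tl tr.
apply/cvgrPdist_le => e e0; near=> n.
have n0 : (0 < n)%N by near: n; exact: nbhs_infty_gt.
have [G0 Gb] := ln_GammaIntegral_asymptotics n0 t1.
have kt k : (1 <= k)%N -> 0 < k%:R + t.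
  by rewrite -(ler1n R) => ?; lra.
have pr0 : 0 < \prod_(1 <= k < n.+1) (k%:R + t).
  by rewrite big_nat_cond; apply: prodr_gt0 => k /andP[/andP[k1 _] _]; exact: kt.
have Gam0 : 0 < `|Gamma t|.
  have := Gamma_prod n t01; rewrite (gtr0_norm G0) => E.
  move: G0; rewrite -E -mulrA pmulr_lgt0// mulr_gt0 ?normr_gt0//.
have E : ln (GammaIntegral (n.+1%:R + t)) =
    logGamma t + ln `|t| + \sum_(1 <= k < n.+1) ln (k%:R + t).
  have Gne : Gamma t != 0 by rewrite -normr_gt0.
  rewrite -(gtr0_norm G0) -Gamma_prod// !lnM ?posrE ?mulr_gt0 ?normr_gt0//.
  by rewrite ln_prod.
have Ef : ln n`!%:R = \sum_(1 <= k < n.+1) ln k%:R :> R.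
  rewrite -ln_prod; last by move=> k; rewrite ltr0n.
  by rewrite fact_prod natr_prod.
have Es : \sum_(1 <= k < n.+1) ln (1 + t / k%:R) =
    \sum_(1 <= k < n.+1) ln (k%:R + t) - \sum_(1 <= k < n.+1) ln k%:R.
  rewrite -sumrB; apply: eq_big_nat => k /andP[k1 _].
  have k0 : (0 : R) < k%:R by rewrite ltr0n.
  rewrite -ln_div ?posrE ?kt//; congr ln; field.
  exact: lt0r_neq0.
rewrite Es -Ef; rewrite E in Gb.
have -> : logGamma t + ln `|t| - (t * ln n%:R - (\sum_(1 <= k < n.+1) ln (k%:R + t) - ln n`!%:R)) =
  logGamma t + ln `|t| + \sum_(1 <= k < n.+1) ln (k%:R + t) - ln n`!%:R - t * ln n%:R by ring.
apply: (le_trans Gb).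
have nR : (0 : R) < n%:R by rewrite ltr0n.
rewrite -ln_div ?posrE ?ltr0n//.
have -> : n.+1%:R / n%:R = 1 + n%:R^-1 :> R by rewrite -natr1; field; exact: lt0r_neq0.
have := @le_ln1Dx R n%:R^-1; rewrite (lt_trans (ltrN10 _)) ?invr_gt0// => /(_ isT) h.
apply: (le_trans h); rewrite invf_ple ?posrE//.
near: n; exact: nbhs_infty_ger.
Unshelve. all: by end_near. Qed.

End euler_limit.

(** * The sine product *)

Section sine_product.
Variable R : realType.
Local Notation mu := (@lebesgue_measure R).
Implicit Types (x s : R).

Lemma Rintegral_derivative (F g : R -> R) (a b : R) : a <= b ->
  (forall s, is_derive s 1 F (g s)) -> continuous g ->
  \int[mu]_(s in `[a, b]) g s = F b - F a.
Proof.
move=> ab dF cg; apply: integrable_derivative_Rintegral => //.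
- by apply: within_oo_continuous => s _; exact: derive_continuous (dF s).
- apply: continuous_compact_integrable; first exact: segment_compact.
  by apply: within_oo_continuous => s _; exact: cg.
Qed.

Lemma continuous_itv_integrable (g : R -> R) (a b : R) : continuous g ->
  mu.-integrable `[a, b] (EFin \o g).
Proof.
move=> cg; apply: continuous_compact_integrable; first exact: segment_compact.
by apply: within_oo_continuous => s _; exact: cg.
Qed.

Lemma continuous_cosX n : continuous (fun s : R => cos s ^+ n).
Proof. move=> s; apply: (@continuous_comp _ _ _ cos (fun y => y ^+ n)); first exact: continuous_cos.
exact: exprn_continuous. Qed.

Lemma continuous_scale_cos c : continuous (fun s : R => cos (c * s)).
Proof.
move=> s; apply: continuous_comp; last exact: continuous_cos.
by apply: cvgMr; exact: cvg_id.
Qed.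

(** Up to a constant, wallis 0 x is sin(pi x) / x, and the recurrence below
    extracts the factors 1 - x^2/k^2 of the sine product one by one. *)
Definition wallis n x := \int[mu]_(s in `[0, pi / 2]) (cos s ^+ n * cos (2 * x * s)).

Lemma wallis_continuous n x : continuous (fun s => cos s ^+ n * cos (2 * x * s)).
Proof. by move=> s; apply: cvgM; [exact: continuous_cosX|exact: continuous_scale_cos]. Qed.

Let pihalf0 : 0 <= pi / 2 :> R.
Proof. by rewrite divr_ge0// pi_ge0. Qed.

Lemma wallis0 x : x != 0 -> wallis 0 x = sin (pi * x) / (2 * x).
Proof.
move=> x0; rewrite /wallis.
have dF s : is_derive s 1 (fun s => sin (2 * x * s) / (2 * x)) (cos s ^+ 0 * cos (2 * x * s)).
  apply: is_derive_eq; rewrite expr0 -![_ *: _]/(_ * _).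
  by field.
rewrite (Rintegral_derivative pihalf0 dF); last exact: wallis_continuous.
rewrite mulr0 sin0 mul0r subr0; by congr (sin _ / _); field.
Qed.

Lemma wallis00 : wallis 0 0 = pi / 2.
Proof.
have dF s : is_derive s 1 id (cos s ^+ 0 * cos (2 * 0 * s)).
  by apply: is_derive_eq; rewrite expr0 mulr0 mul0r cos0 mulr1.
rewrite /wallis (Rintegral_derivative pihalf0 dF) ?subr0//; exact: wallis_continuous.
Qed.

(** The integrand [g] is the derivative of the Wronskian-like expression
    (cos^m)' c - cos^m c' with m = n+2 and c(s) = cos(2xs), which vanishes at 0
    and at pi/2. *)
Lemma wallis_rec n x : n.+2%:R * n.+1%:R * wallis n x =
  (n.+2%:R ^+ 2 - 4 * x ^+ 2) * wallis n.+2 x.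
Proof.
pose A s := - (n.+2%:R * (cos s ^+ n.+1 * sin s * cos (2 * x * s)))
   + 2 * x * (cos s ^+ n.+2 * sin (2 * x * s)).
pose g s := n.+2%:R * n.+1%:R * (cos s ^+ n * cos (2 * x * s)) -
   (n.+2%:R ^+ 2 - 4 * x ^+ 2) * (cos s ^+ n.+2 * cos (2 * x * s)).
have dA s : is_derive s 1 A (g s).
  have dc m := derX m (is_derive_cos s).
  have d1 := derN (dercM n.+2%:R (derM (derM (dc n.+1) (is_derive_sin s))
    (dercoslin (2 * x) s))).
  have d2 := dercM (2 * x) (derM (dc n.+2) (dersinlin (2 * x) s)).
  apply: (is_derive_eq (derD d1 d2)); rewrite /g /= !exprS.
  have s2 : sin s * sin s = 1 - cos s * cos s by rewrite -!expr2 sin2cos2.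
  rewrite -!natr1 ?natrD; set C := cos (2 * x * s); set S := sin (2 * x * s).
  ring: s2.
have cg : continuous g.
  by move=> u; apply: cvgB; apply: cvgMr; exact: wallis_continuous.
have : \int[mu]_(s in `[0, pi / 2]) g s = 0.
  rewrite (Rintegral_derivative pihalf0 dA cg) /A cos_pihalf !expr0n/= mulr0 sin0 mulr0.
  ring.
rewrite RintegralB//; last 2 first.
- by apply: continuous_itv_integrable => s; apply: cvgMr; exact: wallis_continuous.
- by apply: continuous_itv_integrable => s; apply: cvgMr; exact: wallis_continuous.
rewrite !RintegralZl//; last 2 first.
- exact/continuous_itv_integrable/wallis_continuous.
- exact/continuous_itv_integrable/wallis_continuous.
by move/eqP; rewrite subr_eq0 => /eqP.
Qed.

Lemma norm_sin_le s : `|sin s| <= `|s|.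
Proof.
have [m ms] : exists m, `|s| <= m by exists `|s|.
have /(_ 0 s) := @derive_bounded_lipschitz R sin cos (- m) m 1 (fun s _ => is_derive_sin s) (fun s _ => cos_max s).
have m0 : 0 <= m by exact: le_trans ms.
rewrite oppr_le0 m0 sin0 !subr0 mul1r -ler_norml ms; exact.
Qed.

Lemma mul_cos_le_sin s : 0 <= s <= pi / 2 -> s * cos s <= sin s.
Proof.
move=> /andP[s0 s1].
have [c|c|c] := @MVT_segment R (fun u => sin u - u * cos u) (fun u => u * sin u) 0 s s0 _ _.
- move=> _; apply: is_derive_eq; rewrite -![_ *: _]/(_ * _); ring.
- move: c; apply: within_oo_continuous => c _; apply: cvgB; first exact: continuous_sin.
  by apply: cvgM; [exact: cvg_id|exact: continuous_cos].
rewrite in_itv /= sin0 mul0r subrr !subr0 => /andP[c0 cs] E.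
rewrite -subr_ge0 E mulr_ge0// mulr_ge0// sin_ge0_pi// c0.
have := pi_ge0 R; lra.
Qed.

(** As 1 - cos(2xs) <= 2 x^2 s^2 and s cos s <= sin s, the difference is at most
    2 x^2 times the integral of s sin s cos^n s, and the latter is the integral
    of cos^(n+1) s divided by n+1. *)
Lemma wallis_close n x : `|wallis n.+1 0 - wallis n.+1 x| <= 2 * x ^+ 2 / n.+1%:R * wallis n.+1 0.
Proof.
have n0 : (0 : R) < n.+1%:R by [].
have i1 := continuous_itv_integrable 0 (pi / 2) (@wallis_continuous n.+1 0).
have i2 := continuous_itv_integrable 0 (pi / 2) (@wallis_continuous n.+1 x).
pose h s := n.+1%:R * (s * sin s * cos s ^+ n).
have ch : continuous h.
  move=> s; apply: cvgMr; apply: cvgM; last exact: continuous_cosX.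
  by apply: cvgM; [exact: cvg_id|exact: continuous_sin].
have Ih : \int[mu]_(s in `[0, pi / 2]) h s = wallis n.+1 0.
  pose g s := cos s ^+ n.+1 * cos (2 * 0 * s) - h s.
  have dF s : is_derive s 1 (fun s => s * cos s ^+ n.+1) (g s).
    apply: (is_derive_eq (derM (derid s) (derX n.+1 (is_derive_cos s)))).
    by rewrite /g /h mulr0 mul0r cos0 /=; ring.
  have cg : continuous g.
    by move=> s; apply: cvgB; [exact: wallis_continuous|exact: ch].
  have := Rintegral_derivative pihalf0 dF cg.
  rewrite cos_pihalf !expr0n /= mulr0 mul0r subrr RintegralB//; last first.
    exact: continuous_itv_integrable.
  by move=> /eqP; rewrite subr_eq0 => /eqP.
rewrite -[X in _ <= _ * X]Ih -RintegralZl//; last exact: continuous_itv_integrable.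
rewrite /wallis -RintegralB//.
have cd : continuous (fun s => cos s ^+ n.+1 * cos (2 * 0 * s) - cos s ^+ n.+1 * cos (2 * x * s)).
  by move=> s; apply: cvgB; exact: wallis_continuous.
apply: (le_trans (le_normr_Rintegral _ _)) => //; first exact: continuous_itv_integrable.
apply: le_Rintegral => //.
- by apply: continuous_itv_integrable => s; apply: cvg_norm; exact: cd.
- by apply: continuous_itv_integrable => s; apply: cvgMr; exact: ch.
move=> s; rewrite /= in_itv /= => s01; have /andP[s0 s1] := s01.
have c0 : 0 <= cos s.
  apply: cos_ge0_pihalf; rewrite s1 andbT (le_trans _ s0)// oppr_le0//.
rewrite mulr0 mul0r cos0 mulr1 -{1}[cos s ^+ _]mulr1 -mulrBr normrM.
rewrite ger0_norm ?exprn_ge0//.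
have c1 : `|1 - cos (2 * x * s)| <= 2 * x ^+ 2 * s ^+ 2.
  have -> : 2 * x * s = (x * s) *+ 2 by rewrite -mulr_natl; ring.
  rewrite cos_mulr2n cos2sin2 ger0_norm; last first.
    have := sqr_ge0 (sin (x * s)); rewrite -mulr_natl; lra.
  have : sin (x * s) ^+ 2 <= (x * s) ^+ 2.
    by rewrite -(real_normK (num_real (sin _))) -(real_normK (num_real (x * s)))
      ler_pXn2r ?nnegrE ?normr_ge0 // norm_sin_le.
  rewrite exprMn -mulr_natl; nra.
apply: (@le_trans _ _ (cos s ^+ n.+1 * (2 * x ^+ 2 * s ^+ 2))); first by rewrite ler_wpM2l// exprn_ge0.
have -> : cos s ^+ n.+1 * (2 * x ^+ 2 * s ^+ 2) = (2 * x ^+ 2 * s * cos s ^+ n) * (s * cos s).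
  by rewrite exprS; ring.
have -> : 2 * x ^+ 2 / n.+1%:R * h s = (2 * x ^+ 2 * s * cos s ^+ n) * sin s.
  by rewrite /h; field.
apply: ler_wpM2l; last exact: mul_cos_le_sin.
by rewrite mulr_ge0 ?exprn_ge0// mulr_ge0// mulr_ge0// sqr_ge0.
Qed.

Lemma wallis_even_gt0 k : 0 < wallis k.*2 0.
Proof.
elim: k => [|k IH]; first by rewrite wallis00 divr_gt0// pi_gt0.
have := wallis_rec k.*2 0; rewrite expr0n /= mulr0 subr0 => E.
have : 0 < k.*2.+2%:R ^+ 2 * wallis k.*2.+2 0 by rewrite -E !mulr_gt0.
by rewrite pmulr_rgt0 ?exprn_gt0.
Qed.

Lemma sine_product_partial x k : x != 0 ->
  sin (pi * x) / (pi * x) = \prod_(1 <= j < k.+1) (1 - x ^+ 2 / j%:R ^+ 2)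
    * (wallis k.*2 x / wallis k.*2 0).
Proof.
move=> x0; elim: k => [|k ->].
  rewrite big_geq// mul1r wallis0// wallis00.
  have := lt0r_neq0 (pi_gt0 R); set S := sin (pi * x); move: (@pi R) S => P S P0.
  by field; rewrite P0.
rewrite [in RHS]big_nat_recr//= -mulrA; congr (_ * _).
have E := wallis_rec k.*2 x; have E0 := wallis_rec k.*2 0.
have W0 := lt0r_neq0 (wallis_even_gt0 k).
have W1 := lt0r_neq0 (wallis_even_gt0 k.+1); rewrite doubleS in W1 *.
have n2 : (k.*2.+2%:R : R) != 0 by [].
have n1 : (k.*2.+1%:R : R) != 0 by [].
have k1 : (k.+1%:R : R) != 0 by [].
have kk : k.*2.+2%:R = 2 * k.+1%:R :> R by rewrite -natrM mul2n.
rewrite expr0n /= mulr0 subr0 in E0.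
have {}E0 : wallis k.*2 0 = k.*2.+2%:R ^+ 2 * wallis k.*2.+2 0 / (k.*2.+2%:R * k.*2.+1%:R).
  by rewrite -E0 mulrC mulKf// mulf_neq0.
have {}E : wallis k.*2 x = (k.*2.+2%:R ^+ 2 - 4 * x ^+ 2) * wallis k.*2.+2 x
    / (k.*2.+2%:R * k.*2.+1%:R).
  by rewrite -E mulrC mulKf// mulf_neq0.
rewrite E E0 kk.
set a := wallis k.*2.+2 x; set b := wallis k.*2.+2 0 in W1 *.
move: (k.+1%:R) (k.*2.+1%:R) k1 n1 => c d c0 d0.
by field; rewrite c0 d0 W1.
Qed.

Lemma sin_pi_div_gt0 x : 0 < `|x| < 1 -> 0 < sin (pi * x) / (pi * x).
Proof.
move=> /andP[]; rewrite normr_gt0 => x0; rewrite ltr_norml => /andP[h1 h2].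
have main (y : R) : 0 < y -> y < 1 -> 0 < sin (pi * y) / (pi * y).
  move=> y0 y1; rewrite divr_gt0 ?mulr_gt0 ?pi_gt0// sin_gt0_pi//.
  by rewrite mulr_gt0 ?pi_gt0//= gtr_pMr ?pi_gt0.
have [xp|xn|xe] := ltgtP x 0.
- have := main (- x); rewrite mulrN sinN invrN mulrNN; apply; lra.
- exact: main.
- by rewrite xe eqxx in x0.
Qed.

Lemma ln_sine_product x : 0 < `|x| < 1 ->
  (fun n => \sum_(1 <= k < n.+1) ln (1 - x ^+ 2 / k%:R ^+ 2)) @ \oo -->
  ln (sin (pi * x) / (pi * x)).
Proof.
move=> x01; have /andP[x0 x1] := x01; rewrite normr_gt0 in x0.
have s0 := sin_pi_div_gt0 x01.
have f0 k : (1 <= k)%N -> 0 < 1 - x ^+ 2 / k%:R ^+ 2.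
  move=> k1; rewrite subr_gt0 ltr_pdivrMr ?exprn_gt0 ?ltr0n// mul1r.
  rewrite -(real_normK (num_real x)) ltr_pXn2r ?nnegrE//.
  by rewrite (lt_le_trans x1)// ler1n.
pose rho k := wallis k.*2 x / wallis k.*2 0.
have rho0 k : 0 < rho k.
  move: s0; rewrite (sine_product_partial k x0) pmulr_rgt0//.
  by rewrite big_nat_cond; apply: prodr_gt0 => j /andP[/andP[j1 _] _]; exact: f0.
have rho1 : rho @ \oo --> (1 : R).
  apply/cvgrPdist_le => e e0; near=> k.
  have k0 : (0 < k)%N by near: k; exact: nbhs_infty_gt.
  have := wallis_close k.*2.-1 x; rewrite prednK ?double_gt0// => h.
  have W := wallis_even_gt0 k.
  have -> : 1 - rho k = (wallis k.*2 0 - wallis k.*2 x) / wallis k.*2 0.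
    by rewrite /rho; field; exact: lt0r_neq0.
  rewrite normrM normfV (gtr0_norm W) ler_pdivrMr//; apply: (le_trans h).
  rewrite ler_pM2r//.
  rewrite ler_pdivrMr ?ltr0n ?double_gt0//.
  have : 2 * x ^+ 2 / e <= k%:R by near: k; exact: nbhs_infty_ger.
  rewrite ler_pdivrMr// => h2; apply: (le_trans h2).
  rewrite mulrC ler_pM2l// ler_nat -addnn leq_addr//.
have lrho : (fun k => ln (rho k)) @ \oo --> ln (1 : R).
  by apply: continuous_cvg; [exact: continuous_ln|exact: rho1].
rewrite (_ : (fun n => _) = (fun n => ln (sin (pi * x) / (pi * x)) - ln (rho n))).
  by rewrite -[X in _ --> X]subr0 -ln1; apply: cvgB => //; exact: cvg_cst.
apply/funext => n; rewrite -ln_prod// (sine_product_partial n x0).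
rewrite lnM ?posrE ?rho0//; first by rewrite addrK.
by rewrite big_nat_cond; apply: prodr_gt0 => j /andP[/andP[j1 _] _]; exact: f0.
Unshelve. all: by end_near. Qed.

End sine_product.

(** * The Euler-Mascheroni constant and the alternating harmonic series *)

Section clausen1.
Variable R : realType.
Implicit Types (t s a x : R).

Lemma ln_step_bounds x : 0 < x -> (x + 1)^-1 <= ln (x + 1) - ln x <= x^-1.
Proof.
move=> x0; have x1 : 0 < x + 1 by rewrite addr_gt0.
have xV : 0 < x^-1 by rewrite invr_gt0.
have x1V : (x + 1)^-1 < 1 by rewrite invf_lt1// ltrDr.
have xn := lt0r_neq0 x0; have x1n := lt0r_neq0 x1.
apply/andP; split.
  have h1 : -1 < - (x + 1)^-1 by rewrite ltrN2.
  have := le_ln1Dx h1.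
  have -> : 1 + - (x + 1)^-1 = x / (x + 1) by field.
  rewrite ln_div ?posrE//; lra.
have h1 : -1 < x^-1 by rewrite (lt_trans _ xV)// ltrN10.
have := le_ln1Dx h1.
have -> : 1 + x^-1 = (x + 1) / x by field.
by rewrite ln_div ?posrE.
Qed.

Lemma ln_step_nat n : (n.+2%:R)^-1 <= ln (n.+2%:R : R) - ln n.+1%:R <= (n.+1%:R)^-1.
Proof. by rewrite -(natr1 n.+1); exact: ln_step_bounds. Qed.

(** The sequence whose limit defines the Euler-Mascheroni constant. *)
Definition harmonic_ln (n : nat) : R := \sum_(1 <= k < n.+1) (k%:R)^-1 - ln n%:R.

Lemma euler_mascheroni_cvg : harmonic_ln @ \oo --> euler_mascheroni R.
Proof.
suff : cvgn harmonic_ln by [].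
have cS : cvgn (fun n => harmonic_ln n.+1).
  apply: nonincreasing_is_cvgn.
    apply/nonincreasing_seqP => n; rewrite /harmonic_ln [X in X - _ <= _]big_nat_recr//=.
    have /andP[+ _] := ln_step_nat n; rewrite -addrA lerD2l.
    move: (_^-1) (ln _) (ln _) => A B C ABC; lra.
  exists 0 => _ [n _ <-]; rewrite /harmonic_ln subr_ge0.
  have lnH : ln n.+1%:R <= \sum_(1 <= k < n.+1) k%:R^-1 :> R.
    elim: n => [|n IH]; first by rewrite ln1 big_geq.
    rewrite big_nat_recr//=.
    have /andP[_] := ln_step_nat n; rewrite lerBlDl => h; apply: (le_trans h).
    by rewrite lerD2r.
  by rewrite big_nat_recr//= (le_trans lnH)// lerDl invr_ge0.
by have /cvg_ex[l] := cS; rewrite cvg_shiftS => h; apply/cvg_ex; exists l.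
Qed.

(** The partial sum up to 2n is H_n - H_(2n); replacing each harmonic number by
    its logarithm plus gamma leaves - ln 2. *)
Lemma alternating_harmonic_cvg :
  (fun N => \sum_(1 <= k < N.+1) (-1) ^+ k / k%:R) @ \oo --> - ln (2 : R).
Proof.
pose b N : R := \sum_(1 <= k < N.+1) (-1) ^+ k / k%:R.
have beven n : (0 < n)%N -> b n.*2 = harmonic_ln n - harmonic_ln n.*2 - ln 2.
  move=> n0; rewrite /harmonic_ln.
  have -> : ln (n.*2%:R : R) = ln 2 + ln n%:R.
    by rewrite -mul2n natrM lnM ?posrE ?ltr0n.
  rewrite /b; set u := (X in X = _); set v := \sum_(1 <= k < n.+1) _.
  set w := \sum_(1 <= k < n.*2.+1) _.
  suff -> : u = v - w by ring.
  rewrite /u /v /w {u v w n0}; elim: n => [|n IH]; first by rewrite !big_geq// subrr.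
  rewrite doubleS !(@big_nat_recr _ _ _ n.*2.+2 1)//=.
  rewrite !(@big_nat_recr _ _ _ n.*2.+1 1)//= (@big_nat_recr _ _ _ n.+1 1)//= IH.
  rewrite -signr_odd -[(-1) ^+ n.*2.+2]signr_odd /= odd_double /= expr1 expr0.
  have -> : n.*2.+2%:R = 2 * n.+1%:R :> R by rewrite -natrM mul2n doubleS.
  have n1 : (n.+1%:R : R) != 0 by [].
  set S1 := \sum_(1 <= k < n.+1) _; set S2 := \sum_(1 <= k < n.*2.+1) _.
  move: (n.+1%:R) n1 (n.*2.+1%:R^-1) => c c0 d; field.
  exact: c0.
have be : (fun n => b n.*2) @ \oo --> - ln (2 : R).
  have d2 : (fun n => n.*2) @ \oo --> \oo.
    apply/cvgnyPge => A; near=> n.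
    by rewrite (@leq_trans n)//; [near: n; exact: nbhs_infty_ge|rewrite -addnn leq_addr].
  have l : (fun n => harmonic_ln n - harmonic_ln n.*2 - ln 2) @ \oo -->
      euler_mascheroni R - euler_mascheroni R - ln 2.
    apply: cvgB; last exact: cvg_cst.
    apply: cvgB; first exact: euler_mascheroni_cvg.
    exact: (cvg_comp _ _ d2 euler_mascheroni_cvg).
  rewrite subrr sub0r in l; apply: cvg_trans l; apply: near_eq_cvg; near=> n.
  by rewrite beven//; near: n; exact: nbhs_infty_gt.
apply/cvgrPdist_le => e e0.
have e20 : 0 < e / 2 by rewrite divr_gt0.
have /cvgrPdist_le /(_ _ e20) [M _ HM] := be.
near=> N.
have MN : (M <= N./2)%N.
  rewrite -(doubleK M) half_leq//; near: N; exact: nbhs_infty_ge.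
have N0 : (0 < N)%N by near: N; exact: nbhs_infty_gt.
have Ne : N%:R^-1 <= e / 2.
  have : (e / 2)^-1 <= N%:R by near: N; exact: nbhs_infty_ger.
  by rewrite invf_ple ?posrE// ltr0n.
have := HM _ MN; rewrite /=.
have := odd_double_half N; case: (odd N) => /=; rewrite ?add1n ?add0n.
  move=> E h; rewrite -/(b N) -E /b big_nat_recr//= E.
  rewrite opprD addrA; apply: (le_trans (ler_normB _ _)).
  have -> : `|(-1) ^+ N / N%:R| = N%:R^-1 :> R.
    by rewrite normrM normrX normrN1 expr1n mul1r ger0_norm ?invr_ge0.
  by rewrite /b E in h; rewrite [leRHS]splitr; exact: lerD h Ne.
by move=> E h; rewrite -/(b N) -[in b N]E; apply: (le_trans h); rewrite ler_pdivrMr// mulr2n mulrDr mulr1 lerDl ltW.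
Unshelve. all: by end_near. Qed.

End clausen1.

(** * The Fourier series of the logarithm of the sine *)

Section clausen1_uniform.
Variable R : realType.
Implicit Types (t s a x theta : R).

Definition Cl_partial (m : nat) theta (N : nat) : R :=
  \sum_(1 <= k < N)
    (if odd m then cos (k%:R * theta) else sin (k%:R * theta)) / k%:R ^+ m.

Lemma sin_sum_telescope N x :
  2 * sin x * \sum_(1 <= k < N.+1) sin (2 * k%:R * x) = cos x - cos ((2 * N%:R + 1) * x).
Proof.
elim: N => [|N IH]; first by rewrite big_geq// mulr0 mulr0 add0r mul1r subrr.
rewrite big_nat_recr//= mulrDr IH.
have -> : (2 * N.+1%:R + 1) * x = 2 * N.+1%:R * x + x by ring.
have -> : (2 * N%:R + 1) * x = 2 * N.+1%:R * x - x by rewrite -natr1; ring.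
rewrite cosB cosD; ring.
Qed.

(** The N-th partial sum of Cl_1(2 pi t) minus its limit - ln(2 sin(pi t)). *)
Definition Cl1_error (N : nat) t : R :=
  \sum_(1 <= k < N.+1) cos (2 * pi * k%:R * t) / k%:R + ln (2 * sin (pi * t)).

Lemma cos_natpi k : cos (pi * k%:R) = (-1) ^+ k :> R.
Proof.
elim: k => [|k IH]; first by rewrite mulr0 cos0.
by rewrite -natr1 mulrDr mulr1 cosDpi IH exprS mulN1r.
Qed.

(** The sum of the sines is a Dirichlet kernel, which cancels the cotangent
    coming from the logarithm. *)
Lemma is_derive_Cl1_error N t : 0 < t < 1 ->
  is_derive t 1 (Cl1_error N) (pi * cos ((2 * N%:R + 1) * (pi * t)) / sin (pi * t)).
Proof.
move=> /andP[t0 t1].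
have s0 : 0 < sin (pi * t).
  by apply: sin_gt0_pi; rewrite mulr_gt0 ?pi_gt0//= gtr_pMr ?pi_gt0.
have s20 : 0 < 2 * sin (pi * t) by rewrite mulr_gt0.
have d1 : is_derive t 1 (fun s => \sum_(1 <= k < N.+1) cos (2 * pi * k%:R * s) / k%:R)
    (\sum_(1 <= k < N.+1) - (2 * pi) * sin (2 * k%:R * (pi * t))).
  apply: dersum => k /andP[k1 _].
  have k0 : (k%:R : R) != 0 by rewrite pnatr_eq0 -lt0n.
  rewrite (_ : (fun s => _) = (fun s => k%:R^-1 * cos (2 * pi * k%:R * s))); last first.
    by apply/funext => s; rewrite mulrC.
  apply: (is_derive_eq (dercM k%:R^-1 (dercoslin (2 * pi * k%:R) t))).
  rewrite (_ : 2 * k%:R * (pi * t) = 2 * pi * k%:R * t); last by ring.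
  set S := sin _; move: (k%:R : R) k0 S (@pi R) => c c0 S P.
  by field.
have d2 := dercomp (dercM 2 (dersinlin pi t)) (is_derive1_ln s20).
apply: (is_derive_eq (derD d1 d2)).
rewrite -mulr_sumr.
have T := sin_sum_telescope N (pi * t).
set S := \sum_(_ <= k < _) _ in T *.
have -> : cos ((2 * N%:R + 1) * (pi * t)) = cos (pi * t) - 2 * sin (pi * t) * S by rewrite T; ring.
move: (lt0r_neq0 s0); move: (sin (pi * t)) (cos (pi * t)) S {T s0 s20 d1 d2} => a b S a0.
by field.
Qed.

(** The derivative oscillates but is not small, so the oscillating term
    sin((2N+1) pi t) / ((2N+1) sin(pi t)) is subtracted first: what remains has a
    derivative of order 1/N.  The constant of integration is fixed at t = 1/2,
    where the partial sum is the alternating harmonic sum. *)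
Lemma Cl1_error_bound a : 0 < a < 2^-1 -> exists2 e : R^nat, e @ \oo --> 0 &
  forall N t, a <= t <= 1 - a -> `|Cl1_error N t| <= e N.
Proof.
move=> /andP[a0 a1].
have itv t : a <= t <= 1 - a -> 0 < t < 1.
  by move=> /andP[h1 h2]; apply/andP; split; lra.
have spos t : 0 < t < 1 -> 0 < sin (pi * t).
  by move=> /andP[h1 h2]; apply: sin_gt0_pi; rewrite mulr_gt0 ?pi_gt0//= gtr_pMr ?pi_gt0.
(* the sine is bounded away from 0 on the segment *)
have [m m0 mP] : exists2 m, 0 < m & forall t, a <= t <= 1 - a -> m <= sin (pi * t).
  have [||c ca cP] := @EVT_min R (fun t => sin (pi * t)) a (1 - a).
  - lra.
  - apply: within_oo_continuous => t _; exact: (derive_continuous (dersinlin pi t)).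
  exists (sin (pi * c)); last by move=> t ta; apply: cP; rewrite in_itv.
  by apply/spos/itv; rewrite in_itv in ca.
pose h N : R := (2 * N%:R + 1)^-1.
have h0 N : 0 < h N by rewrite invr_gt0 ltr_wpDl// mulr_ge0.
have hlim : h @ \oo --> 0.
  apply: (@squeeze_cvgr _ _ _ _ (cst 0) (@harmonic R)); last 2 first.
  - exact: cvg_cst.
  - exact: cvg_harmonic.
  near=> n; rewrite (ltW (h0 n)) /= lef_pV2 ?posrE -?natr1; last 2 first.
  - by rewrite ltr_wpDl// mulr_ge0.
  - by rewrite ltr_wpDl.
  - have : (0 : R) <= n%:R by []; lra.
(* subtract the oscillating term, whose derivative is the main part of that of the error *)
pose E N t := Cl1_error N t - h N * sin ((2 * N%:R + 1) * pi * t) / sin (pi * t).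
pose dE N t := h N * (pi * sin ((2 * N%:R + 1) * pi * t) * cos (pi * t) / sin (pi * t) ^+ 2).
have dEP N t : 0 < t < 1 -> is_derive t 1 (E N) (dE N t).
  move=> t01; have s0 := spos t t01.
  have d1 := dersinlin ((2 * N%:R + 1) * pi) t.
  have d2 := derV (lt0r_neq0 s0) (dersinlin pi t).
  apply: (is_derive_eq (derB (is_derive_Cl1_error N t01) (derM (dercM (h N) d1) d2))).
  rewrite /dE /h; have n0 : 2 * N%:R + 1 != 0 :> R by rewrite lt0r_neq0// ltr_wpDl// mulr_ge0.
  rewrite (mulrA (2 * N%:R + 1) pi t).
  set S := sin ((2 * N%:R + 1) * pi * t); set C := cos ((2 * N%:R + 1) * pi * t).
  move: (lt0r_neq0 s0) S C; move: (sin (pi * t)) (cos (pi * t)) (2 * N%:R + 1 : R) n0 (@pi R).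
  move=> a' b c c0 P a'0 S C; field.
  by rewrite a'0 c0.
have dEb N t : a <= t <= 1 - a -> `|dE N t| <= h N * (pi / m ^+ 2).
  move=> ta; have ms := mP t ta.
  rewrite /dE normrM (gtr0_norm (h0 N)) ler_pM2l// normrM normfV normrM normrM.
  rewrite (gtr0_norm (pi_gt0 R)) -mulrA -mulrA ler_pM2l ?pi_gt0//.
  rewrite (gtr0_norm (exprn_gt0 2 (lt_le_trans m0 ms))).
  apply: (@le_trans _ _ (1 * (1 / sin (pi * t) ^+ 2))).
    apply: ler_pM; rewrite ?normr_ge0 ?sin_max//.
      by rewrite divr_ge0// exprn_ge0// (le_trans (ltW m0)).
    by rewrite ler_pM2r ?invr_gt0 ?exprn_gt0 ?(lt_le_trans m0)// cos_max.
  rewrite !mul1r lef_pV2 ?posrE ?exprn_gt0// ?(lt_le_trans m0)//.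
  by rewrite ler_pXn2r ?nnegrE ?(le_trans (ltW m0))// ltW.
have half : a <= 2^-1 <= 1 - a by apply/andP; split; lra.
have K0 : 0 <= pi / m ^+ 2 by rewrite divr_ge0 ?pi_ge0 ?sqr_ge0.
have Eb N t : a <= t <= 1 - a -> `|E N t - E N (2^-1)| <= h N * (pi / m ^+ 2).
  move=> ta.
  have d s : a <= s <= 1 - a -> is_derive s 1 (E N) (dE N s) by move=> /itv; exact: dEP.
  apply: (le_trans (derive_bounded_lipschitz d (dEb N) half ta)).
  apply: ler_piMr; first by apply: mulr_ge0; [exact: ltW|exact: K0].
  by case/andP: ta => ? ?; rewrite ler_norml; apply/andP; split; lra.
pose e (N : nat) : R := `|Cl1_error N 2^-1| + h N + h N * (pi / m ^+ 2) + h N / m.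
exists e.
  have l1 : Cl1_error ^~ 2^-1 @ \oo --> (0 : R).
    rewrite -(addNr (ln 2)) (_ : Cl1_error ^~ 2^-1 =
      (fun N => \sum_(1 <= k < N.+1) (-1) ^+ k / k%:R + ln 2)).
      by apply: cvgD; [exact: alternating_harmonic_cvg|exact: cvg_cst].
    apply/funext => N; rewrite /Cl1_error sin_pihalf mulr1; congr (_ + _).
    by apply: eq_bigr => k _; rewrite -cos_natpi; congr (cos _ / _); field.
  have l2 : e @ \oo --> (`|0 : R| + 0 + 0 * (pi / m ^+ 2) + 0 / m : R).
    have hc c : (fun N => h N * c) @ \oo --> 0 * c by exact: cvgM hlim (cvg_cst c).
    exact: (cvgD (cvgD (cvgD (cvg_norm l1) hlim) (hc (pi / m ^+ 2))) (hc m^-1)).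
  by rewrite normr0 !mul0r !addr0 in l2.
move=> N t ta; have ms := mP t ta.
have sm : `|h N * sin ((2 * N%:R + 1) * pi * t) / sin (pi * t)| <= h N / m.
  rewrite normrM normrM (gtr0_norm (h0 N)) -mulrA ler_pM2l// normfV.
  rewrite -[leRHS]mul1r ler_pM ?normr_ge0 ?sin_max// (gtr0_norm (lt_le_trans m0 ms)).
  by rewrite lef_pV2 ?posrE// (lt_le_trans m0).
have sh : `|h N * sin ((2 * N%:R + 1) * pi * 2^-1) / sin (pi * 2^-1)| <= h N.
  rewrite sin_pihalf divr1 normrM (gtr0_norm (h0 N)).
  by rewrite ler_piMr ?(ltW (h0 N))// sin_max.
have := Eb N t ta; rewrite /E /e.
set u := Cl1_error N t; set v := Cl1_error N 2^-1.
move: sm sh; set x := h N * _ / _; set y := h N * _ / _ => sm sh h1.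
have -> : u = (u - x - (v - y)) + x + v - y by ring.
apply: (le_trans (ler_normB _ _)); apply: (le_trans (lerD (ler_normD _ _) (lexx _))).
apply: (le_trans (lerD (lerD (ler_normD _ _) (lexx _)) (lexx _))); lra.
Unshelve. all: by end_near. Qed.

Lemma Cl1_uniform a : 0 < a < 2^-1 -> exists2 e : R^nat, e @ \oo --> 0 &
  forall N t, a <= `|t| <= 1 - a ->
  `|Cl_partial 1 (2 * pi * t) N - - ln (2 * sin (pi * `|t|))| <= e N.
Proof.
move=> a01; have [e e0 eP] := Cl1_error_bound a01.
exists (fun N => e N.-1).
  by rewrite -(cvg_shiftS (fun N => e N.-1)).
move=> N t ta; have := eP N.-1 _ ta; rewrite /Cl1_error opprK.
suff -> : Cl_partial 1 (2 * pi * t) N =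
    \sum_(1 <= k < N.-1.+1) cos (2 * pi * k%:R * `|t|) / k%:R by [].
have -> : \sum_(1 <= k < N.-1.+1) cos (2 * pi * k%:R * `|t|) / k%:R =
    \sum_(1 <= k < N) cos (2 * pi * k%:R * `|t|) / k%:R.
  by case: N => //; rewrite !big_geq.
apply: eq_bigr => k _; rewrite /= expr1; congr (_ / _).
have [tp|tn] := ger0P t; first by congr cos; ring.
by rewrite -cosN; congr cos; ring.
Qed.

Lemma Cl1E t : 0 < `|t| < 1 -> Cl_partial 1 (2 * pi * t) @ \oo --> - ln (2 * sin (pi * `|t|)).
Proof.
move=> /andP[t0 t1].
pose a := Num.min `|t| (1 - `|t|) / 2.
have a0 : 0 < Num.min `|t| (1 - `|t|) by rewrite lt_min t0 subr_gt0.
have /andP[at1 at2] : (Num.min `|t| (1 - `|t|) <= `|t|) && (Num.min `|t| (1 - `|t|) <= 1 - `|t|).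
  by rewrite -le_min.
have [|e e0 eP] := @Cl1_uniform a; first by rewrite /a; apply/andP; split; lra.
apply/cvgrPdist_le => eps eps0.
have /cvgrPdist_le /(_ _ eps0) := e0; apply: filterS => N; rewrite sub0r normrN => h.
rewrite distrC; apply: (le_trans (eP N t _)); first by rewrite /a; apply/andP; split; lra.
exact: le_trans (ler_norm _) h.
Qed.

End clausen1_uniform.

(** * Zeta values and the series of the inverse hyperbolic tangent *)

Section odd_zeta_series.
Variable R : realType.
Implicit Types (t s a x r : R).

(** Compare with the telescoping sum of 1/k - 1/(k+1). *)
Lemma zeta2_partial_cvg : cvgn (fun N : nat => \sum_(1 <= k < N) (k%:R ^+ 2)^-1 : R).
Proof.
apply: nondecreasing_is_cvgn.
  apply/nondecreasing_seqP => -[|n]; first by rewrite !big_geq.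
  by rewrite [leRHS]big_nat_recr//= lerDl invr_ge0 exprn_ge0.
exists 2 => _ [N _ <-].
suff H n : \sum_(1 <= k < n.+2) (k%:R ^+ 2)^-1 <= 2 - n.+1%:R^-1 :> R.
  case: N => [|[|n]]; [by rewrite big_geq|by rewrite big_geq|].
  by apply: (le_trans (H n)); rewrite gerBl invr_ge0.
elim: n => [|n IH]; first by rewrite big_nat1 expr1n invr1; lra.
rewrite big_nat_recr//=; apply: (le_trans (lerD IH (lexx _))).
rewrite -(natr1 n.+1); have c0 : (0 : R) < n.+1%:R by [].
move: (n.+1%:R) c0 => c c0.
have cn := lt0r_neq0 c0; have c1 : 0 < c + 1 by rewrite addr_gt0.
rewrite -subr_ge0.
have -> : 2 - (c + 1)^-1 - (2 - c^-1 + ((c + 1) ^+ 2)^-1) = (c * (c + 1) ^+ 2)^-1.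
  by field; rewrite cn lt0r_neq0.
by rewrite invr_ge0 mulr_ge0 ?exprn_ge0 ?ltW.
Qed.

Lemma zeta_partial_cvg (s : nat) : (2 <= s)%N ->
  (fun N : nat => \sum_(1 <= k < N) (k%:R ^+ s)^-1 : R) @ \oo --> zeta R s.
Proof.
move=> s2; have [|//] := @dominated_series R (fun k => (k%:R ^+ s)^-1) _ _ zeta2_partial_cvg.
move=> k k0; have k1 : (1 : R) <= k%:R by rewrite ler1n.
rewrite ger0_norm ?invr_ge0 ?exprn_ge0// lef_pV2 ?posrE ?exprn_gt0 ?ltr0n//.
exact: ler_weXn2l.
Qed.

Lemma zeta_ge0 (s : nat) : (2 <= s)%N -> 0 <= zeta R s.
Proof.
move=> /zeta_partial_cvg h; apply: (ler_cvg_to (cvg_cst 0) h); apply: nearW => N.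
by apply: sumr_ge0 => k _; rewrite invr_ge0 exprn_ge0.
Qed.

Lemma zeta_le2 (s : nat) : (2 <= s)%N -> zeta R s <= zeta R 2.
Proof.
move=> s2; apply: (ler_cvg_to (zeta_partial_cvg s2) (zeta_partial_cvg (leqnn 2))).
apply: nearW => N; rewrite big_nat_cond [leRHS]big_nat_cond; apply: ler_sum => k /andP[/andP[k0 _] _].
have k1 : (1 : R) <= k%:R by rewrite ler1n.
by rewrite lef_pV2 ?posrE ?exprn_gt0 ?ltr0n//; exact: ler_weXn2l.
Qed.

(** artanh x - x *)
Definition artanh_tail x : R := (ln (1 + x) - ln (1 - x)) / 2 - x.

Definition artanh_tail_partial N x : R := \sum_(1 <= n < N) x ^+ (2 * n + 1) / (2 * n + 1)%:R.

Lemma geometric_even N x : (1 - x ^+ 2) * \sum_(0 <= n < N) x ^+ (2 * n) = 1 - x ^+ (2 * N).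
Proof.
elim: N => [|N IH]; first by rewrite big_geq// mulr0 muln0 subrr.
rewrite big_nat_recr//= mulrDr IH mulnS exprD; ring.
Qed.

(** The remainder has derivative s^(2N+2) / (1 - s^2) and vanishes at 0. *)
Lemma artanh_tail_bound N x : `|x| < 1 ->
  `|artanh_tail x - artanh_tail_partial N.+1 x| <= `|x| ^+ (2 * N.+1 + 1) / (1 - x ^+ 2).
Proof.
move=> x1.
have sq s : - `|x| <= s <= `|x| -> 0 < 1 - x ^+ 2 <= 1 - s ^+ 2.
  rewrite -ler_norml => sx; rewrite -(real_normK (num_real x)) -(real_normK (num_real s)).
  rewrite subr_gt0 lerD2l lerN2 expr_lt1// x1 /=.
  by rewrite ler_pXn2r ?nnegrE.
pose f s := artanh_tail s - artanh_tail_partial N.+1 s.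
pose df s := s ^+ (2 * N.+1) / (1 - s ^+ 2).
have fd s : - `|x| <= s <= `|x| -> is_derive s 1 f (df s).
  move=> sx; have s1 : -1 < s < 1.
    by case/andP: sx => h1 h2; apply/andP; split; lra.
  have /andP[s1l s1r] := s1.
  have p1 : 0 < 1 + s by lra.
  have p2 : 0 < 1 - s by lra.
  have d0 : is_derive s 1 (fun _ : R => 1 : R) 0 by exact: is_derive_cst.
  have d1 := dercomp (derD d0 (derid s)) (is_derive1_ln p1).
  have d2 := dercomp (derB d0 (derid s)) (is_derive1_ln p2).
  have d3 := derB (dercM 2^-1 (derB d1 d2)) (derid s).
  have d4 : is_derive s 1 (artanh_tail_partial N.+1) (\sum_(1 <= n < N.+1) s ^+ (2 * n)).
    apply: dersum => n _.
    rewrite (_ : (fun s => _) = (fun s : R => (2 * n + 1)%:R^-1 * s ^+ (2 * n + 1))); last first.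
      by apply/funext => u; rewrite mulrC.
    apply: (is_derive_eq (dercM (2 * n + 1)%:R^-1 (derpow (2 * n + 1) s))).
    by rewrite mulKf ?addn1// pnatr_eq0.
  rewrite (_ : f = (fun s => (2^-1 * (ln (1 + s) - ln (1 - s)) - s)
      - artanh_tail_partial N.+1 s)); last first.
    by apply/funext => u; rewrite /f /artanh_tail [_ / 2]mulrC.
  apply: (is_derive_eq (derB d3 d4)).
  have G := geometric_even N.+1 s; rewrite big_nat_recl//= muln0 expr0 in G.
  rewrite -(big_add1 _ _ 0 N.+1 predT (fun n => s ^+ (2 * n))) in G.
  have [_ sge] := andP (sq s sx); have q : 1 - s ^+ 2 != 0.
    by rewrite lt0r_neq0// (lt_le_trans _ sge)//; case/andP: (sq s sx).
  rewrite /df; have -> : s ^+ (2 * N.+1) = 1 - (1 - s ^+ 2) * (1 + \sum_(1 <= n < N.+1) s ^+ (2 * n)).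
    by rewrite G; ring.
  move: (\sum_(1 <= n < N.+1) _) => S.
  by field; rewrite q (lt0r_neq0 p1) (lt0r_neq0 p2).
have fC s : - `|x| <= s <= `|x| -> `|df s| <= `|x| ^+ (2 * N.+1) / (1 - x ^+ 2).
  move=> sx; have /andP[q1 q2] := sq s sx.
  rewrite /df normrM normfV (gtr0_norm (lt_le_trans q1 q2)) normrX.
  rewrite ler_pM ?invr_ge0 ?exprn_ge0 ?(le_trans (ltW q1) q2)//.
    by rewrite ler_pXn2r ?nnegrE// ler_norml.
  by rewrite lef_pV2 ?posrE// (lt_le_trans q1).
have h0 : - `|x| <= 0 <= `|x| by rewrite oppr_le0 normr_ge0.
have hx : - `|x| <= x <= `|x| by rewrite -ler_norml.
have := derive_bounded_lipschitz fd fC h0 hx.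
have -> : f 0 = 0.
  rewrite /f /artanh_tail /artanh_tail_partial addr0 !subr0 subrr mul0r sub0r.
  by rewrite big1 ?oppr0// => n _; rewrite addn1 expr0n mul0r.
rewrite !subr0 => h.
by rewrite addn1 exprSr mulrAC; exact: h.
Qed.

(** The factor 1/k^2 makes the remainders summable over k, uniformly in t. *)
Lemma artanh_tail_k_bound N k r t : 0 <= r < 1 -> `|t| <= r -> (0 < k)%N ->
  `|artanh_tail (t / k%:R) - artanh_tail_partial N.+1 (t / k%:R)| <=
  (k%:R ^+ 2)^-1 * (r ^+ (2 * N.+1 + 1) / (1 - r ^+ 2)).
Proof.
move=> /andP[r0 r1] tr k0; have k1 : (1 : R) <= k%:R by rewrite ler1n.
have kp : (0 : R) < k%:R by rewrite ltr0n.
have ntk : `|t / k%:R| = `|t| / k%:R by rewrite normrM normfV (gtr0_norm kp).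
have tkr : `|t / k%:R| <= r / k%:R by rewrite ntk ler_pM2r ?invr_gt0.
have rk : r / k%:R <= r by rewrite ler_piMr// invf_le1.
apply: (le_trans (artanh_tail_bound N _)); first by rewrite (le_lt_trans tkr)// (le_lt_trans rk).
rewrite mulrA; apply: ler_pM.
- by rewrite exprn_ge0.
- by rewrite invr_ge0 subr_ge0 -(real_normK (num_real _)) expr_le1// (le_trans tkr)// (le_trans rk)// ltW.
- rewrite ler_pdivlMl ?exprn_gt0//.
  apply: (@le_trans _ _ (k%:R ^+ 2 * (r / k%:R) ^+ (2 * N.+1 + 1))).
    by rewrite ler_pM2l ?exprn_gt0// ler_pXn2r ?nnegrE// divr_ge0// ltW.
  rewrite mulnS -addnA; set M := (2 * N + 1)%N.
  rewrite (exprD (r / k%:R)) (exprD r) mulrA.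
  have -> : k%:R ^+ 2 * (r / k%:R) ^+ 2 = r ^+ 2.
    by rewrite -exprMn mulrC divfK// lt0r_neq0.
  apply: ler_wpM2l; first exact: exprn_ge0.
  have rk0 : 0 <= r / k%:R by rewrite divr_ge0// ltW.
  by rewrite ler_pXn2r ?nnegrE// /M addn1.
- have sq : (t / k%:R) ^+ 2 <= r ^+ 2.
    rewrite -(real_normK (num_real (t / _))) ler_pXn2r ?nnegrE//.
    exact: le_trans rk.
  have r2 : r ^+ 2 < 1 by rewrite expr_lt1.
  by rewrite lef_pV2 ?posrE ?subr_gt0 ?lerD2l ?lerN2// (le_lt_trans sq).
Qed.

End odd_zeta_series.

(** * The odd zeta series and log Gamma *)

Section odd_logGamma.
Variable R : realType.
Implicit Types (t s a x r : R).

Definition zeta_odd_sum N t : R :=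
  \sum_(1 <= n < N) zeta R (2 * n + 1) * t ^+ (2 * n + 1) / (2 * n + 1)%:R.

(** Minus gamma t minus the odd part of log Gamma(1+t), with the even part
    eliminated by the sine product. *)
Definition odd_logGamma t : R :=
  - (euler_mascheroni R * t) - logGamma t - ln (2 * sin (pi * `|t|)) / 2
  + ln (2 * pi) / 2 - ln `|t| / 2.

(** Splitting log(1 + t/k) into its even and odd parts in t turns Euler's limit
    into the sine product, gamma, and the sum of artanh(t/k) - t/k. *)
Lemma artanh_tail_sum_cvg t : 0 < `|t| < 1 ->
  (fun K => \sum_(1 <= k < K.+1) artanh_tail (t / k%:R)) @ \oo --> odd_logGamma t.
Proof.
move=> t01; have /andP[t0 t1] := t01.
pose A n := t * ln n%:R - \sum_(1 <= k < n.+1) ln (1 + t / k%:R).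
pose B n := \sum_(1 <= k < n.+1) ln (1 - t ^+ 2 / k%:R ^+ 2).
have E K : \sum_(1 <= k < K.+1) artanh_tail (t / k%:R) =
    - (B K / 2) - A K - t * harmonic_ln R K.
  rewrite /A /B /harmonic_ln.
  have -> : - ((\sum_(1 <= k < K.+1) ln (1 - t ^+ 2 / k%:R ^+ 2)) / 2)
   - (t * ln K%:R - \sum_(1 <= k < K.+1) ln (1 + t / k%:R))
   - t * (\sum_(1 <= k < K.+1) k%:R^-1 - ln K%:R) =
   - ((\sum_(1 <= k < K.+1) ln (1 - t ^+ 2 / k%:R ^+ 2)) * 2^-1)
   + \sum_(1 <= k < K.+1) ln (1 + t / k%:R) - t * \sum_(1 <= k < K.+1) k%:R^-1 by ring.
  rewrite mulr_suml mulr_sumr -sumrN -big_split /= -sumrB; apply: eq_big_nat => k /andP[k1 _].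
  have kp : (0 : R) < k%:R by rewrite ltr0n.
  have kge1 : (1 : R) <= k%:R by rewrite ler1n.
  have tk : `|t / k%:R| < 1.
    rewrite normrM normfV (gtr0_norm kp) ltr_pdivrMr// mul1r.
    exact: lt_le_trans kge1.
  move: tk; rewrite ltr_norml => /andP[h1 h2].
  have p1 : 0 < 1 + t / k%:R by lra.
  have p2 : 0 < 1 - t / k%:R by lra.
  have -> : 1 - t ^+ 2 / k%:R ^+ 2 = (1 - t / k%:R) * (1 + t / k%:R).
    by field; exact: lt0r_neq0.
  by rewrite lnM ?posrE// /artanh_tail; field; exact: lt0r_neq0.
have -> : (fun K => \sum_(1 <= k < K.+1) artanh_tail (t / k%:R)) =
    (fun K => - (B K / 2) - A K - t * harmonic_ln R K) by apply/funext => n; exact: E.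
have -> : odd_logGamma t = - (ln (sin (pi * t) / (pi * t)) / 2) - (logGamma t + ln `|t|)
    - t * euler_mascheroni R.
  have -> : sin (pi * t) / (pi * t) = sin (pi * `|t|) / (pi * `|t|).
    case: (ger0P t) => // _; rewrite mulrN sinN invrN mulrNN//.
  have s0 : 0 < sin (pi * `|t|) by rewrite sin_gt0_pi// mulr_gt0 ?pi_gt0//= gtr_pMr ?pi_gt0.
  have p0 := pi_gt0 R.
  by rewrite /odd_logGamma !ln_div ?posrE ?mulr_gt0// !lnM ?posrE//; field.
apply: cvgB; last by apply: cvgMr; exact: euler_mascheroni_cvg.
apply: cvgB; last exact: logGamma_euler.
apply: cvgN; apply: cvgMl; exact: ln_sine_product.
Qed.

(** For a fixed truncation of artanh, summing over k up to K and letting K grow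
    gives the zeta values; the bound on the remainder is uniform in K. *)
Lemma odd_logGamma_series_bound N r t : 0 <= r < 1 -> 0 < `|t| <= r ->
  `|zeta_odd_sum N.+1 t - odd_logGamma t| <=
    zeta R 2 * (r ^+ (2 * N.+1 + 1) / (1 - r ^+ 2)).
Proof.
move=> r01 /andP[t0 tr]; have /andP[r0 r1] := r01.
have t01 : 0 < `|t| < 1 by rewrite t0 (le_lt_trans tr).
have l1 : (fun K => \sum_(1 <= k < K.+1) artanh_tail_partial N.+1 (t / k%:R)) @ \oo -->
    zeta_odd_sum N.+1 t.
  have -> : (fun K => \sum_(1 <= k < K.+1) artanh_tail_partial N.+1 (t / k%:R)) =
      (fun K => \sum_(1 <= n < N.+1)
      (\sum_(1 <= k < K.+1) (k%:R ^+ (2 * n + 1))^-1) * t ^+ (2 * n + 1) / (2 * n + 1)%:R).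
    apply/funext => L; rewrite /artanh_tail_partial exchange_big /=; apply: eq_bigr => n _.
    by rewrite mulr_suml mulr_suml; apply: eq_bigr => k _; rewrite expr_div_n [_ * t ^+ _]mulrC.
  rewrite /zeta_odd_sum; elim: N => [|N IH].
    rewrite big_geq//; under eq_fun do rewrite big_geq//.
    exact: cvg_cst.
  rewrite big_nat_recr//=; under eq_fun do rewrite big_nat_recr//=.
  apply: cvgD; first exact: IH.
  apply: cvgMl; apply: cvgMl.
  rewrite (cvg_shiftS (fun K => \sum_(1 <= k < K) (k%:R ^+ (2 * N.+1 + 1))^-1 : R)).
  by apply: zeta_partial_cvg; rewrite mulnS.
have l2 : (fun K => `|\sum_(1 <= k < K.+1) artanh_tail_partial N.+1 (t / k%:R) -
    \sum_(1 <= k < K.+1) artanh_tail (t / k%:R)|) @ \oo -->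
    `|zeta_odd_sum N.+1 t - odd_logGamma t|.
  exact: cvg_norm (cvgB l1 (artanh_tail_sum_cvg t01)).
have l3 : (fun K => (\sum_(1 <= k < K.+1) (k%:R ^+ 2)^-1) * (r ^+ (2 * N.+1 + 1) / (1 - r ^+ 2)))
   @ \oo --> zeta R 2 * (r ^+ (2 * N.+1 + 1) / (1 - r ^+ 2)).
  apply: cvgMl; rewrite (cvg_shiftS (fun K => \sum_(1 <= k < K) (k%:R ^+ 2)^-1 : R)).
  exact: zeta_partial_cvg.
apply: (ler_cvg_to l2 l3); apply: nearW => K /=.
rewrite -sumrB mulr_suml; apply: (le_trans (ler_norm_sum _ _ _)).
rewrite big_nat_cond [leRHS]big_nat_cond; apply: ler_sum => k /andP[/andP[k0 _] _].
by rewrite distrC; exact: artanh_tail_k_bound.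
Qed.

End odd_logGamma.

(** * Locally uniform approximation of log Gamma *)

Section logGamma_approximation.
Variable R : realType.
Implicit Types (t s a x r : R).

Lemma is_derive_ln_norm t : t != 0 -> is_derive t 1 (fun s => ln `|s|) (t^-1).
Proof.
move=> t0; have [tp|tn|te] := ltgtP t 0; last by rewrite te eqxx in t0.
- have d : is_derive t 1 (fun s => ln (- s)) t^-1.
    have tn : 0 < - t by rewrite oppr_gt0.
    apply: (is_derive_eq (dercomp (derN (derid t)) (is_derive1_ln tn))).
    by rewrite invrN mulrNN mulr1.
  apply: near_eq_is_derive d; near=> s; rewrite ltr0_norm//.
  by near: s; exact: lt_nbhsl.
- apply: near_eq_is_derive (is_derive1_ln tn); near=> s; rewrite gtr0_norm//.
  by near: s; exact: lt_nbhsr.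
Unshelve. all: by end_near. Qed.

(** With u = sqrt|t|, |t ln|t|| = 2 u^2 |ln u| <= 2 u. *)
Lemma mul_ln_norm_continuous0 n : {for 0, continuous (fun t : R => t ^+ n.+1 * ln `|t|)}.
Proof.
apply/cvgrPdist_le => e e0.
rewrite expr0n mul0r.
have sq : {for 0, continuous (fun t : R => 2 * Num.sqrt `|t|)}.
  apply: cvgMr; apply: continuous_comp; last exact: sqrt_continuous.
  exact: norm_continuous.
have /cvgrPdist_le /(_ _ e0) := sq; rewrite normr0 sqrtr0 mulr0 => H.
near=> t.
have t1 : `|t| < 1.
  rewrite ltr_norml; near: t; apply: ball_itv_oo; lra.
have h : `|0 - 2 * Num.sqrt `|t| | <= e by near: t.
rewrite sub0r normrN; apply: le_trans h; rewrite sub0r normrN.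
have [->|tn0] := eqVneq t 0; first by rewrite expr0n mul0r normr0.
have tp : 0 < `|t| by rewrite normr_gt0.
have sp : 0 < Num.sqrt `|t| by rewrite sqrtr_gt0.
set u := Num.sqrt `|t| in sp *.
have tu : `|t| = u ^+ 2 by rewrite sqr_sqrtr.
rewrite normrM normrX exprS tu.
have u1 : u <= 1 by rewrite -(ler_pXn2r (ltn0Sn 1)) ?nnegrE ?(ltW sp)// -tu expr1n ltW.
rewrite lnXn// -[ln u *+ 2]mulr_natl [`|2 * ln u|]normrM (gtr0_norm (ltr0Sn _ 1)).
have lu : `|ln u| <= u^-1.
  rewrite ler0_norm ?ln_le0// -lnV ?posrE//; apply: ltW; apply: ln_sublinear.
  by rewrite invr_gt0.
rewrite (gtr0_norm (mulr_gt0 (ltr0Sn _ 1) sp)).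
have ub : (u ^+ 2) ^+ n <= 1 by rewrite exprn_ile1 ?sqr_ge0// expr_le1// ltW.
have un := lt0r_neq0 sp.
apply: (@le_trans _ _ (u ^+ 2 * 1 * (2 * u^-1))).
  apply: ler_pM.
  - by apply: mulr_ge0; [exact: sqr_ge0|apply: exprn_ge0; exact: sqr_ge0].
  - by apply: mulr_ge0.
  - by apply: ler_wpM2l => //; exact: sqr_ge0.
  - by apply: ler_wpM2l.
by rewrite le_eqVlt; apply/orP; left; apply/eqP; field.
Unshelve. all: by end_near. Qed.

(** The sign is that of Cl_(m+1)' = Cl_m for m + 1 even and - Cl_m for m + 1
    odd. *)
Lemma is_derive_Cl_partial m N c t :
  is_derive t 1 (fun s => Cl_partial m.+1 (c * s) N)
    ((-1) ^+ (odd m.+1) * c * Cl_partial m (c * t) N).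
Proof.
rewrite /Cl_partial mulr_sumr; apply: dersum => k /andP[k1 _].
have k0 : (k%:R : R) != 0 by rewrite pnatr_eq0 -lt0n.
have E (F : R -> R) s : F (k%:R * (c * s)) / k%:R ^+ m.+1 = k%:R ^- m.+1 * F (k%:R * c * s).
  by rewrite mulrC mulrA.
rewrite /=; case: (odd m) => /=.
  rewrite (_ : (fun s => _) = fun s => k%:R ^- m.+1 * sin (k%:R * c * s)); last first.
    by apply/funext => s; exact: E.
  apply: (is_derive_eq (dercM _ (dersinlin (k%:R * c) t))).
  rewrite [k%:R * (c * t)]mulrA; move: (cos _) => C; rewrite exprS expr0.
  have := expf_neq0 m k0; move: (k%:R ^+ m) => K K0; move: (k%:R) k0 => q q0.
  by field; rewrite q0 K0.
rewrite (_ : (fun s => _) = fun s => k%:R ^- m.+1 * cos (k%:R * c * s)); last first.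
  by apply/funext => s; exact: E.
apply: (is_derive_eq (dercM _ (dercoslin (k%:R * c) t))).
rewrite [k%:R * (c * t)]mulrA; move: (sin _) => C; rewrite exprS expr1.
have := expf_neq0 m k0; move: (k%:R ^+ m) => K K0; move: (k%:R) k0 => q q0.
by field; rewrite q0 K0.
Qed.

Lemma cvg0_scale c (e : R^nat) : e @ \oo --> 0 -> (fun N => c * e N) @ \oo --> 0.
Proof.
move=> e0; have l : (fun N => c * e N) @ \oo --> c * 0 by exact: cvgMr.
by rewrite mulr0 in l.
Qed.

(** A common bound for the tails of all the series Cl_m with m >= 2. *)
Definition zeta2_tail N : R := zeta R 2 - \sum_(1 <= k < N) (k%:R ^+ 2)^-1.

Lemma zeta2_tail_cvg0 : zeta2_tail @ \oo --> 0.
Proof.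
rewrite -(subrr (zeta R 2)); apply: cvgB; first exact: cvg_cst.
exact: zeta_partial_cvg.
Qed.

Lemma Cl_partial_dominated m theta : (2 <= m)%N ->
  Cl_partial m theta @ \oo --> Cl m theta /\
  forall N, `|Cl_partial m theta N - Cl m theta| <= zeta2_tail N.
Proof.
move=> m2; pose w k : R :=
  (if odd m then cos (k%:R * theta) else sin (k%:R * theta)) / k%:R ^+ m.
have [|h1 h2] := @dominated_series R w _ _ (@zeta2_partial_cvg R); last by split.
move=> k k0; have k1 : (1 : R) <= k%:R by rewrite ler1n.
rewrite normrM normfV (@ger0_norm _ (k%:R ^+ m)) ?exprn_ge0// -[leRHS]mul1r.
apply: ler_pM; rewrite ?normr_ge0 ?invr_ge0 ?exprn_ge0//.
  by case: ifP => _; [exact: cos_max|exact: sin_max].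
rewrite lef_pV2 ?posrE ?exprn_gt0 ?ltr0n//.
exact: ler_weXn2l.
Qed.

Lemma uniform_cvg (U : nat -> R -> R) (u : R -> R) (e : R^nat) t : e @ \oo --> 0 ->
  (forall N, `|U N t - u t| <= e N) -> U ^~ t @ \oo --> u t.
Proof.
move=> e0 h; apply/cvgrPdist_le => eps eps0.
have /cvgrPdist_le /(_ _ eps0) := e0; apply: filterS => N; rewrite sub0r normrN => hN.
by rewrite distrC (le_trans (h N))// (le_trans (ler_norm _)).
Qed.

(** A neighbourhood of t on which the error of the approximation of Cl_1 is
    uniform: it stays away from 0, 1 and -1. *)
Lemma punctured_interval t : 0 < `|t| < 1 -> exists a lo hi : R,
  [/\ 0 < a < 2^-1, lo < t < hi & forall s, lo < s < hi -> a <= `|s| <= 1 - a].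
Proof.
move=> /andP[t0 t1]; have [m m0 /andP[m1 m2]] : exists2 m : R, 0 < m & (m <= `|t|) && (m <= 1 - `|t|).
  by exists (Num.min `|t| (1 - `|t|)); rewrite ?lt_min ?t0 ?subr_gt0// -le_min.
move: m1 m2; case: (ger0P t) t0 t1 => [tp|tn] t0 t1 m1 m2.
  exists (m / 2), (m / 2), (1 - m / 2); split.
  - by apply/andP; split; lra.
  - by apply/andP; split; lra.
  - by move=> s /andP[h1 h2]; rewrite ger0_norm; [apply/andP; split|]; lra.
exists (m / 2), (- (1 - m / 2)), (- (m / 2)); split.
- by apply/andP; split; lra.
- by apply/andP; split; lra.
- by move=> s /andP[h1 h2]; rewrite ler0_norm; [apply/andP; split|]; lra.
Qed.

(** Formula (1) of the introduction solved for log|Gamma(t)|, with both series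
    truncated. *)
Definition logGamma_partial N t : R :=
  - (euler_mascheroni R * t) - zeta_odd_sum N t + Cl_partial 1 (2 * pi * t) N / 2
  + ln (2 * pi) / 2 - ln `|t| / 2.

Lemma logGamma_partial_continuous N t : t != 0 -> {for t, continuous (logGamma_partial N)}.
Proof.
move=> t0.
have d1 := derN (derlin (euler_mascheroni R) t).
have dz : is_derive t 1 (zeta_odd_sum N)
    (\sum_(1 <= n < N) (2 * n + 1)%:R^-1 * (zeta R (2 * n + 1) * ((2 * n + 1)%:R * t ^+ (2 * n + 1).-1))).
  rewrite (_ : zeta_odd_sum N = fun s => \sum_(1 <= n < N)
      (2 * n + 1)%:R^-1 * (zeta R (2 * n + 1) * s ^+ (2 * n + 1))).
    by apply: dersum => n _; apply: dercM; apply: dercM; exact: derpow.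
  by apply/funext => s; apply: eq_bigr => n _; rewrite mulrC.
have dc := dercM 2^-1 (is_derive_Cl_partial 0 N (2 * pi) t).
have d2 := derD (derB d1 dz) dc.
have d3 := derD d2 (is_derive_cst (ln (2 * pi) / 2 : R) t (1 : R)).
have -> : logGamma_partial N = (fun s => - (euler_mascheroni R * s) - zeta_odd_sum N s
    + 2^-1 * Cl_partial 1 (2 * pi * s) N + ln (2 * pi) / 2 - 2^-1 * ln `|s|).
  by apply/funext => s; rewrite /logGamma_partial; ring.
exact: derive_continuous (derB d3 (dercM 2^-1 (is_derive_ln_norm t0))).
Qed.

Lemma logGamma_uniform a : 0 < a < 2^-1 -> exists2 e : R^nat, e @ \oo --> 0 &
  forall N t, a <= `|t| <= 1 - a -> `|logGamma_partial N t - logGamma t| <= e N.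
Proof.
move=> a01; have /andP[a0 a1] := a01; have [e e0 eP] := Cl1_uniform a01.
pose r := 1 - a; have r01 : 0 <= r < 1 by rewrite /r; apply/andP; split; lra.
have /andP[r0 r1] := r01.
pose c := zeta R 2 / (1 - r ^+ 2).
have c0 : 0 <= c.
  by rewrite divr_ge0 ?zeta_ge0// subr_ge0 expr_le1// ltW.
exists (fun N => c * r ^+ N.-1 + e N / 2).
  rewrite -[X in _ --> X](addr0 0); apply: cvgD; last first.
    by under eq_cvg do rewrite mulrC; exact: cvg0_scale.
  apply: cvg0_scale; rewrite -(cvg_shiftS (fun N => r ^+ N.-1)).
  by apply: cvg_expr; rewrite ger0_norm.
move=> N t ta; have /andP[ta1 ta2] := ta.
have tr : 0 < `|t| <= r by rewrite ta2 andbT (lt_le_trans a0).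
have h1 : `|zeta_odd_sum N t - odd_logGamma t| <= c * r ^+ N.-1.
  have -> : zeta_odd_sum N t = zeta_odd_sum N.-1.+1 t.
    by case: N => //; rewrite /zeta_odd_sum !big_geq.
  apply: (le_trans (odd_logGamma_series_bound _ r01 tr)).
  rewrite /c -mulrA ler_wpM2l ?zeta_ge0// mulrC ler_wpM2l//.
    by rewrite invr_ge0 subr_ge0 expr_le1// ltW.
  apply: ler_wiXn2l => //; [exact: ltW|lia].
have h2 := eP N t ta.
have -> : logGamma_partial N t - logGamma t =
   - (zeta_odd_sum N t - odd_logGamma t) + (Cl_partial 1 (2 * pi * t) N -
     - ln (2 * sin (pi * `|t|))) / 2.
  rewrite /logGamma_partial /odd_logGamma; ring.
apply: (le_trans (ler_normD _ _)); rewrite normrN lerD//.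
by rewrite normrM (@ger0_norm _ 2^-1)// ler_pM2r.
Qed.

Lemma logGamma_continuous t : 0 < `|t| < 1 -> {for t, continuous (@logGamma R)}.
Proof.
move=> t01; have [a [lo [hi [a01 lth P]]]] := punctured_interval t01.
have [e e0 eP] := logGamma_uniform a01.
apply: (uniform_limit_continuous_at e0 _ lth).
  by move=> N s /P; exact: eP.
move=> N; apply: logGamma_partial_continuous.
by case/andP: t01; rewrite normr_gt0.
Qed.

End logGamma_approximation.

(** * A primitive of p t^(p-1) log|Gamma(t)| *)

Section moment_primitive_theory.
Variable R : realType.
Implicit Types (t s a x r : R).
Variable p : nat.
Hypothesis p_gt0 : (0 < p)%N.

(** The coefficient of z^(p-k) Cl_(k+1)(2 pi z) once the closed form is multiplied
    by z^(p+1). *)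
Definition clausen_coef k : R :=
  p`!%:R * (-1) ^+ (k.+1)./2 * pi / ((p - k)`!%:R * (2 * pi) ^+ k.+1).

(** The terms k = 1, ..., p of the Clausen sum, whose series converge
    absolutely. *)
Definition clausen_part_partial N t : R :=
  \sum_(0 <= k < p) clausen_coef k.+1 * t ^+ (p - k.+1) * Cl_partial k.+2 (2 * pi * t) N.

(** The derivative of the k-th term is a(k) - a(k-1), by the product rule and the
    sign pattern of the Clausen coefficients; a(p) = 0 because t^0 is constant. *)
Lemma is_derive_clausen_part_partial N t :
  is_derive t 1 (clausen_part_partial N)
    (- (p%:R * t ^+ p.-1 * (Cl_partial 1 (2 * pi * t) N / 2))).
Proof.
pose a k := clausen_coef k * ((p - k)%:R * t ^+ (p - k).-1) * Cl_partial k.+1 (2 * pi * t) N.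
have -> : - (p%:R * t ^+ p.-1 * (Cl_partial 1 (2 * pi * t) N / 2)) =
    \sum_(0 <= k < p) (a k.+1 - a k).
  rewrite telescope_sumr// /a subnn mul0r mulr0 mul0r sub0r subn0 /clausen_coef subn0 expr1 expr0.
  have f0 : (p`!%:R : R) != 0 by rewrite pnatr_eq0 -lt0n fact_gt0.
  have P0 := lt0r_neq0 (pi_gt0 R).
  move: (Cl_partial _ _ _) => C; move: (t ^+ p.-1) (p`!%:R) f0 (@pi R) P0 (p%:R) => T f f0 P P0 q.
  by field; rewrite f0 P0.
apply: dersum => k /andP[_ kp].
have d := derM (dercM (clausen_coef k.+1) (derpow (p - k.+1) t))
  (is_derive_Cl_partial k.+1 N (2 * pi) t).
apply: (is_derive_eq d); rewrite /a; congr (_ + _).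
have -> : (p - k).-1 = (p - k.+1)%N by rewrite subnS.
rewrite /clausen_coef.
have -> : (p - k)`! = ((p - k) * (p - k.+1)`!)%N.
  by rewrite -{1}(prednK (n := p - k)) ?subn_gt0// factS prednK ?subn_gt0// subnS.
have s : (-1) ^+ k.+2./2 * (-1) ^+ odd k.+2 = - (-1) ^+ k.+1./2 :> R.
  rewrite /= negbK uphalf_half; case: (odd k) => /=.
    by rewrite add1n expr1 mulrN1.
  by rewrite add0n expr0 mulr1 exprS mulN1r.
have q0 : ((p - k)%:R : R) != 0 by rewrite pnatr_eq0 -lt0n subn_gt0.
have f0 : ((p - k.+1)`!%:R : R) != 0 by rewrite pnatr_eq0 -lt0n fact_gt0.
have P0 := lt0r_neq0 (pi_gt0 R).
rewrite natrM (exprS _ k.+1).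
move: s; move: ((-1) ^+ k.+2./2) ((-1) ^+ odd k.+2) ((-1) ^+ k.+1./2) => s1 s2 s3 s.
have P1 : (2 * pi) ^+ k.+1 != 0 :> R by rewrite expf_neq0// mulf_neq0.
move: (Cl_partial _ _ _) => C; move: (t ^+ _) (p`!%:R) => T f.
move: ((2 * pi) ^+ k.+1) P1 => X X0; move: (@pi R) P0 => P P0.
move: ((p - k)%:R) q0 ((p - k.+1)`!%:R) f0 => q q0 g g0.
have -> : s3 = - (s1 * s2) by rewrite s opprK.
by field; rewrite q0 g0 X0 P0.
Qed.

(** A primitive of p t^(p-1) times the truncated odd zeta series. *)
Definition zeta_part_partial N t : R :=
  \sum_(1 <= n < N) zeta R (2 * n + 1) * (p%:R / ((2 * n + 1)%:R * (2 * n + p + 1)%:R))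
     * t ^+ (2 * n + p + 1).

Definition moment_primitive_partial N t : R :=
  - (euler_mascheroni R * p%:R / p.+1%:R * t ^+ p.+1) - zeta_part_partial N t
  - clausen_part_partial N t + ln (2 * pi) / 2 * t ^+ p
  - 2^-1 * (t ^+ p * ln `|t| - p%:R^-1 * t ^+ p).

Definition zeta_part t : R := limn (zeta_part_partial ^~ t).

Definition clausen_part t : R :=
  \sum_(0 <= k < p) clausen_coef k.+1 * t ^+ (p - k.+1) * Cl k.+2 (2 * pi * t).

(** The limit of [moment_primitive_partial].  The last term is the primitive of
    - p t^(p-1) ln|t| / 2. *)
Definition moment_primitive t : R :=
  - (euler_mascheroni R * p%:R / p.+1%:R * t ^+ p.+1) - zeta_part t
  - clausen_part t + ln (2 * pi) / 2 * t ^+ p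
  - 2^-1 * (t ^+ p * ln `|t| - p%:R^-1 * t ^+ p).

Lemma is_derive_zeta_part_partial N t :
  is_derive t 1 (zeta_part_partial N) (p%:R * t ^+ p.-1 * zeta_odd_sum N t).
Proof.
rewrite /zeta_odd_sum mulr_sumr; apply: dersum => n _.
apply: (is_derive_eq (dercM _ (derpow _ t))).
have n1 : ((2 * n + 1)%:R : R) != 0 by rewrite addn1 pnatr_eq0.
have n2 : ((2 * n + p + 1)%:R : R) != 0 by rewrite addn1 pnatr_eq0.
have -> : ((2 * n + p + 1).-1 = p.-1 + (2 * n + 1))%N.
  by have := p_gt0; lia.
rewrite exprD; move: ((2 * n + 1)%:R) n1 ((2 * n + p + 1)%:R) n2 => c c0 d d0.
by field; rewrite c0 d0.
Qed.

Lemma is_derive_moment_primitive_partial N t : t != 0 ->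
  is_derive t 1 (moment_primitive_partial N) (p%:R * t ^+ p.-1 * logGamma_partial N t).
Proof.
move=> t0.
have d1 := derN (dercM (euler_mascheroni R * p%:R / p.+1%:R) (derpow p.+1 t)).
have d2 := derB d1 (is_derive_zeta_part_partial N t).
have d3 := derB d2 (is_derive_clausen_part_partial N t).
have d4 := derD d3 (dercM (ln (2 * pi) / 2) (derpow p t)).
have d5 := derB (derM (derpow p t) (is_derive_ln_norm t0)) (dercM p%:R^-1 (derpow p t)).
apply: (is_derive_eq (derB d4 (dercM 2^-1 d5))).
rewrite /logGamma_partial /=.
have p0 : (p%:R : R) != 0 by rewrite pnatr_eq0 -lt0n.
have p1 : (p.+1%:R : R) != 0 by [].
have -> : t ^+ p = t * t ^+ p.-1 by rewrite -exprS prednK.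
move: (Cl_partial _ _ _) (ln `|t|) (ln (2 * pi)) (zeta_odd_sum _ _) (euler_mascheroni R) => C L M Z g.
move: (t ^+ p.-1) (p%:R) p0 (p.+1%:R) p1 => T q q0 q1 q10.
by field; rewrite t0 q0 q10.
Qed.

Lemma clausen_part_partial_continuous N t : {for t, continuous (clausen_part_partial N)}.
Proof. exact: derive_continuous (is_derive_clausen_part_partial N t). Qed.

(** At 0 the logarithm is not differentiable, but t^p ln|t| is continuous. *)
Lemma moment_primitive_partial_continuous N t : {for t, continuous (moment_primitive_partial N)}.
Proof.
have [->|t0] := eqVneq t 0; last exact: derive_continuous (is_derive_moment_primitive_partial N t0).
apply: cvgB; last first.
  apply: cvgMr; apply: cvgB.
    by rewrite -(prednK p_gt0); exact: mul_ln_norm_continuous0.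
  by apply: cvgMr; exact: exprn_continuous.
apply: cvgD; last by apply: cvgMr; exact: exprn_continuous.
apply: cvgB; last exact: clausen_part_partial_continuous.
apply: cvgB; last exact: (derive_continuous (is_derive_zeta_part_partial N 0)).
by apply: cvgN; apply: cvgMr; exact: exprn_continuous.
Qed.

Lemma clausen_part_uniform : exists2 e : R^nat, e @ \oo --> 0 &
  forall N t, `|t| <= 1 -> `|clausen_part_partial N t - clausen_part t| <= e N.
Proof.
exists (fun N => (\sum_(0 <= k < p) `|clausen_coef k.+1|) * zeta2_tail R N).
  by apply: cvg0_scale; exact: zeta2_tail_cvg0.
move=> N t t1; rewrite -sumrB mulr_suml; apply: (le_trans (ler_norm_sum _ _ _)).
apply: ler_sum => k _; rewrite -mulrBr normrM.
have [_ h] := @Cl_partial_dominated R k.+2 (2 * pi * t) isT.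
apply: ler_pM => //; rewrite normrM ler_piMr//.
by rewrite normrX exprn_ile1.
Qed.

Lemma zeta_part_uniform r : 0 <= r < 1 -> exists2 e : R^nat, e @ \oo --> 0 &
  forall N t, `|t| <= r -> `|zeta_part_partial N t - zeta_part t| <= e N.
Proof.
move=> /andP[r0 r1].
have cM : cvgn (fun N => \sum_(1 <= n < N) zeta R 2 * p%:R * r ^+ n).
  have /cvg_ex[l hl] := @is_cvg_geometric_series R (zeta R 2 * p%:R) r ltac:(by rewrite ger0_norm).
  apply/cvg_ex; exists (l - zeta R 2 * p%:R); rewrite -cvg_shiftS.
  rewrite (_ : (fun n => _) = (fun n => series (geometric (zeta R 2 * p%:R) r) n.+1 - zeta R 2 * p%:R)).
    apply: cvgB; last exact: cvg_cst.
    by rewrite cvg_shiftS.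
  apply/funext => n; rewrite /series /geometric /= [in RHS]big_nat_recl//= expr0 mulr1 [RHS]addrC addKr.
  by rewrite big_add1.
exists (fun N => limn (fun N => \sum_(1 <= n < N) zeta R 2 * p%:R * r ^+ n)
    - \sum_(1 <= n < N) zeta R 2 * p%:R * r ^+ n).
  rewrite -[X in _ --> X](subrr (limn (fun N => \sum_(1 <= n < N) zeta R 2 * p%:R * r ^+ n))).
  by apply: cvgB => //; exact: cvg_cst.
move=> N t tr; have [|_] := @dominated_series R (fun n => zeta R (2 * n + 1) *
  (p%:R / ((2 * n + 1)%:R * (2 * n + p + 1)%:R)) * t ^+ (2 * n + p + 1)) _ _ cM; last exact.
move=> k k0; rewrite normrM normrX; apply: ler_pM => //.
- rewrite normrM; apply: ler_pM => //.
    by rewrite ger0_norm ?zeta_le2 ?zeta_ge0//; lia.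
  rewrite ger0_norm ?divr_ge0 ?mulr_ge0// ler_pdivrMr ?mulr_gt0 ?ltr0n ?addn1//.
  rewrite ler_peMr// -natrM ler1n//.
- apply: (@le_trans _ _ (r ^+ (2 * k + p + 1))); first by rewrite ler_pXn2r ?nnegrE// addn1.
  apply: ler_wiXn2l => //; [exact: ltW|lia].
Qed.

Lemma moment_primitive_uniform r : 0 <= r < 1 -> exists2 e : R^nat, e @ \oo --> 0 &
  forall N t, `|t| <= r -> `|moment_primitive_partial N t - moment_primitive t| <= e N.
Proof.
move=> r01; have [e1 l1 h1] := zeta_part_uniform r01; have [e2 l2 h2] := clausen_part_uniform.
exists (fun N => e1 N + e2 N); first by rewrite -[X in _ --> X](addr0 0); exact: cvgD.
move=> N t tr; have t1 : `|t| <= 1 by case/andP: r01 => _ /ltW; exact: le_trans.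
have -> : moment_primitive_partial N t - moment_primitive t =
    - (zeta_part_partial N t - zeta_part t) - (clausen_part_partial N t - clausen_part t).
  by rewrite /moment_primitive_partial /moment_primitive; ring.
by apply: (le_trans (ler_normB _ _)); rewrite normrN lerD ?h1 ?h2.
Qed.

(** This includes t = 0, where log|Gamma| is singular. *)
Lemma moment_primitive_continuous t : `|t| < 1 -> {for t, continuous moment_primitive}.
Proof.
move=> t1; pose r := (1 + `|t|) / 2.
have r01 : 0 <= r < 1 by rewrite /r; have := normr_ge0 t; move=> ?; apply/andP; split; lra.
have [e e0 eP] := moment_primitive_uniform r01.
have tr : - r < t < r by rewrite -ltr_norml /r; lra.
apply: (uniform_limit_continuous_at e0 _ tr).
  by move=> N s; rewrite -ltr_norml => /ltW; exact: eP.
by move=> N; exact: moment_primitive_partial_continuous.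
Qed.

Lemma is_derive_moment_primitive t : 0 < `|t| < 1 ->
  is_derive t 1 moment_primitive (p%:R * t ^+ p.-1 * logGamma t).
Proof.
move=> t01; have [a [lo [hi [a01 lth P]]]] := punctured_interval t01.
have /andP[a0 a1] := a01.
have [e e0 eP] := logGamma_uniform a01.
have r01 : 0 <= 1 - a < 1 by apply/andP; split; lra.
have [e' e'0 e'P] := moment_primitive_uniform r01.
have pe0 : (fun N => p%:R * e N) @ \oo --> 0 by exact: cvg0_scale.
apply: (@is_derive_uniform_limit R moment_primitive_partial
  (fun N s => p%:R * s ^+ p.-1 * logGamma_partial N s) moment_primitive
  (fun s => p%:R * s ^+ p.-1 * logGamma s) lo hi _ t pe0 _ _ _ lth).
- move=> N s /P /andP[h _]; apply: is_derive_moment_primitive_partial.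
  by rewrite -normr_gt0 (lt_le_trans a0).
- move=> N s /P sa; rewrite -mulrBr normrM; apply: ler_pM => //; last exact: eP.
  rewrite normrM normr_nat ler_piMr// normrX exprn_ile1//.
  by case/andP: sa => _; lra.
- by move=> s /P /andP[_ h]; apply: (uniform_cvg e'0) => N; exact: e'P.
- apply: cvgM; last exact: logGamma_continuous.
  by apply: cvgMr; exact: exprn_continuous.
Qed.

End moment_primitive_theory.

(** * Integrals of log Gamma from 0 to z *)

Section negapolygamma_sum.
Variable R : realType.
Local Notation mu := (@lebesgue_measure R).
Implicit Types (t s a b r z : R).

(** In formula (1) the terms that are unbounded near 0, - ln|t| / 2 and
    - ln(2 sin) / 2, are bounded below. *)
Lemma logGamma_bounded_below r : 0 <= r < 1 ->
  exists M : R, forall t, 0 < `|t| <= r -> - M <= logGamma t.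
Proof.
move=> r01; have /andP[r0 r1] := r01.
exists (`|euler_mascheroni R| + zeta R 2 * (r ^+ (2 * 1 + 1) / (1 - r ^+ 2)) + ln 2 / 2 - ln (2 * pi) / 2).
move=> t tr; have /andP[t0 t1] := tr.
have := odd_logGamma_series_bound 0 r01 tr.
rewrite /zeta_odd_sum big_geq// sub0r normrN.
set B := zeta R 2 * _; rewrite ler_norml /odd_logGamma => /andP[h1 h2].
have lt1 : `|t| < 1 by exact: le_lt_trans r1.
have s0 : 0 < sin (pi * `|t|) by rewrite sin_gt0_pi// mulr_gt0 ?pi_gt0//= gtr_pMr ?pi_gt0.
have l1 : ln (2 * sin (pi * `|t|)) <= ln 2.
  by rewrite ler_ln ?posrE ?mulr_gt0// ler_piMr// sin_le1.
have l2 : ln `|t| <= 0 by rewrite ln_le0// ltW.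
have l3 : euler_mascheroni R * t <= `|euler_mascheroni R|.
  by rewrite (le_trans (ler_norm _))// normrM ler_piMr// ltW.
lra.
Qed.

Lemma segment_norm a b z t : a = Num.min 0 z -> b = Num.max 0 z -> a < t < b -> 0 < `|t| < `|z|.
Proof.
move=> -> ->; have [z0|z0] := leP 0 z => /andP[h1 h2].
- by rewrite gtr0_norm// h1 ger0_norm.
- by rewrite ltr0_norm// oppr_gt0 h2 ltr0_norm// ltrN2.
Qed.

Variable z : R.
Hypothesis z01 : 0 < `|z| < 1.
Let a := Num.min 0 z.
Let b := Num.max 0 z.

Let ab : a < b.
Proof.
rewrite /a /b; have [z0|//] := leP 0 z.
by case/andP: z01; rewrite normr_gt0 => zn0 _; rewrite lt_neqAle z0 eq_sym zn0.
Qed.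

Let segment01 t : a < t < b -> 0 < `|t| < 1.
Proof.
move=> /(segment_norm erefl erefl) /andP[-> h] /=.
by case/andP: z01 => _; exact: lt_trans.
Qed.

Let segment_lt1 t : a <= t <= b -> `|t| < 1.
Proof.
case/andP: z01 => _ z1; rewrite /a /b; have [z0|z0] := leP 0 z => /andP[h1 h2].
- by rewrite ger0_norm// (le_lt_trans h2)// (le_lt_trans (ler_norm z)).
- by rewrite ler0_norm// (le_lt_trans _ z1)// ltr0_norm// lerN2.
Qed.

Lemma moment_primitive_within_continuous p : (0 < p)%N -> {within `[a, b], continuous (@moment_primitive R p)}.
Proof.
move=> p0; apply: within_oo_continuous => t; rewrite in_itv /= => /segment_lt1.
exact: moment_primitive_continuous.
Qed.

(** The primitive for p = 1 is a primitive of log|Gamma| itself. *)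
Lemma logGamma_integrable : mu.-integrable `[a, b] (EFin \o @logGamma R).
Proof.
have zr : 0 <= `|z| < 1 by have /andP[_ h] := z01; rewrite normr_ge0.
have [M MP] := logGamma_bounded_below zr.
apply: (@bounded_below_derivative_integrable R (@moment_primitive R 1) (@logGamma R) a b M ab).
- exact: moment_primitive_within_continuous.
- move=> t /segment01 t01; have := @is_derive_moment_primitive R 1 (ltn0Sn 0) t t01.
  by rewrite expr0 !mul1r.
- by move=> t; rewrite in_itv /= => /segment01; exact: logGamma_continuous.
- move=> t tab; apply: MP; have /andP[-> h] := segment_norm erefl erefl tab.
  exact: ltW.
Qed.

Lemma mul_logGamma_integrable (h : R -> R) : continuous h ->
  mu.-integrable `[a, b] (EFin \o (fun t => h t * logGamma t)).
Proof.
move=> ch.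
have ip : mu.-integrable `[a, b] ((EFin \o h) \* (EFin \o @logGamma R))%E.
  apply: integrableMr => //; last exact: logGamma_integrable.
    by apply: measurable_funTS; exact: continuous_measurable_fun.
  have ch' : {within `[a, b], continuous h} by apply: within_oo_continuous => t _; exact: ch.
  have /compact_bounded[M [_ mrt]] := continuous_compact ch' (@segment_compact _ a b).
  by exists M; split; rewrite ?num_real // => ? ? ? ?; exact: mrt.
by apply: (eq_integrable _ _ _ _ ip) => // t _; rewrite /= EFinM.
Qed.

Lemma moment_integral p : (0 < p)%N ->
  \int[mu]_(t in `[a, b]) (p%:R * t ^+ p.-1 * logGamma t) = moment_primitive p b - moment_primitive p a.
Proof.
move=> p0.
have ch : continuous (fun t : R => p%:R * t ^+ p.-1).
  by move=> t; apply: cvgMr; exact: exprn_continuous.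
apply: integrable_derivative_Rintegral; first exact: ltW.
- exact: moment_primitive_within_continuous.
- by move=> t /segment01; exact: is_derive_moment_primitive.
- move=> t; rewrite in_itv /= => /segment01 t01; apply: cvgM; first exact: ch.
  exact: logGamma_continuous.
- exact: mul_logGamma_integrable.
Qed.

Lemma oriented_integralE (f : R -> R) :
  oriented_integral 0 z f = (if 0 <= z then 1 else -1) * \int[mu]_(t in `[a, b]) f t.
Proof.
rewrite /oriented_integral /a /b; have [z0|z0] := leP 0 z; first by rewrite mul1r.
by rewrite mulN1r.
Qed.

Lemma oriented_moment_integral p : (0 < p)%N ->
  oriented_integral 0 z (fun t => p%:R * t ^+ p.-1 * logGamma t) = moment_primitive p z - moment_primitive p 0.
Proof.
move=> p0; rewrite oriented_integralE moment_integral// /a /b.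
by have [z0|z0] := leP 0 z; rewrite ?mul1r// mulN1r opprB.
Qed.

(** Linearity; the factors [h k] are continuous, hence bounded on the segment. *)
Lemma oriented_integral_sum n (c : nat -> R) (h : nat -> R -> R) :
  (forall k, continuous (h k)) ->
  \sum_(0 <= k < n) c k * oriented_integral 0 z (fun t => h k t * logGamma t) =
  oriented_integral 0 z (fun t => (\sum_(0 <= k < n) c k * h k t) * logGamma t).
Proof.
move=> ch; under eq_bigr do rewrite oriented_integralE.
rewrite oriented_integralE; set e := (if _ then _ else _).
elim: n => [|n IH].
  rewrite big_geq// (_ : (fun t => _) = cst 0); last by apply/funext => t; rewrite big_geq// mul0r.
  by rewrite Rintegral_cst// mul0r mulr0.
rewrite big_nat_recr//= IH.
have cs : continuous (fun t => \sum_(0 <= k < n) c k * h k t).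
  elim: n {IH} => [|m IHm].
    have -> : (fun t => \sum_(0 <= k < 0) c k * h k t) = cst 0.
      by apply/funext => t; rewrite big_geq.
    by move=> t; exact: cvg_cst.
  have -> : (fun t => \sum_(0 <= k < m.+1) c k * h k t) =
      (fun t => \sum_(0 <= k < m) c k * h k t + c m * h m t).
    by apply/funext => t; rewrite big_nat_recr.
  by move=> t; apply: cvgD; [exact: IHm|apply: cvgMr; exact: ch].
rewrite mulrCA -mulrDr; congr (_ * _).
rewrite -RintegralZl//; last exact: mul_logGamma_integrable.
rewrite -RintegralD//.
- by apply: eq_Rintegral => t _; rewrite big_nat_recr//= mulrDl mulrA.
- exact: mul_logGamma_integrable.
- have cc : continuous (fun t => c n * h n t) by move=> t; apply: cvgMr; exact: ch.
  have -> : (fun t => c n * (h n t * logGamma t)) = (fun t => c n * h n t * logGamma t).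
    by apply/funext => t; rewrite mulrA.
  exact: mul_logGamma_integrable cc.
Qed.

End negapolygamma_sum.

(** * The negapolygamma sum, and Clausen values *)

Section closed_form.
Variable R : realType.
Implicit Types (z t : R).

(** The binomial formula for t = z - (z - t). *)
Lemma binomial_recenter q z t : t ^+ q =
  \sum_(0 <= j < q.+1) ('C(q, j)%:R * (-1) ^+ j * z ^+ (q - j)) * (z - t) ^+ j.
Proof.
have {1}-> : t = z + - (z - t) by ring.
rewrite exprDn big_mkord; apply: eq_bigr => j _.
rewrite -mulr_natl [(- (z - t)) ^+ j]exprNn; ring.
Qed.

(** The term k = 0 is log|Gamma(z)| / z.  The others are integrals of powers of
    z - t against log|Gamma(t)|, and their combination recomposes p t^(p-1). *)
Lemma negapolygamma_sum p z : (0 < p)%N -> 0 < `|z| < 1 ->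
  \sum_(0 <= k < p.+1)
      (p`!%:R * (-1) ^+ k * negapolygamma k.+1 z) / ((p - k)`!%:R * z ^+ k.+1) =
  logGamma z / z - (moment_primitive p z - moment_primitive p 0) / z ^+ p.+1.
Proof.
case: p => // q _ z01; have z0 : z != 0 by case/andP: z01; rewrite normr_gt0.
have f0 n : (n`!%:R : R) != 0 by rewrite pnatr_eq0 -lt0n fact_gt0.
rewrite big_nat_recl// subn0 expr0 expr1 mulr1 /=.
congr (_ + _); first by field; rewrite z0 f0.
rewrite -(@oriented_moment_integral _ _ z01 q.+1)//=.
pose O j := oriented_integral 0 z (fun t => (z - t) ^+ j * logGamma t).
transitivity (\sum_(0 <= j < q.+1)
   - (z ^+ q.+2)^-1 * (q.+1%:R * ('C(q, j)%:R * (-1) ^+ j * z ^+ (q - j)) * O j)).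
  apply: eq_big_nat => j /andP[_ jq]; rewrite subSS -/(O j).
  have jq' : (j <= q)%N by [].
  rewrite factS natrM -(bin_fact jq') !natrM.
  have -> : z ^+ q.+2 = z ^+ (q - j) * z ^+ j.+2.
    by rewrite -exprD; congr (_ ^+ _); lia.
  have zj : z ^+ j.+2 != 0 by rewrite expf_neq0.
  have zqj : z ^+ (q - j) != 0 by rewrite expf_neq0.
  rewrite exprS; move: (O j) ('C(q, j)%:R) => o B.
  move: (z ^+ j.+2) zj (z ^+ (q - j)) zqj => X X0 Y Y0.
  move: (j`!%:R) (f0 j) ((q - j)`!%:R) (f0 (q - j)%N) => g g0 h h0.
  by field; rewrite g0 h0 X0 Y0.
rewrite -mulr_sumr (@oriented_integral_sum _ _ z01 _ _ (fun j t => (z - t) ^+ j)).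
  rewrite mulNr mulrC; congr (- (oriented_integral _ _ _ / _)); apply/funext => t.
  rewrite [in RHS](binomial_recenter q z) mulr_sumr; congr (_ * _).
  by apply: eq_bigr => j _; rewrite [RHS]mulrA.
move=> k t; apply: (@continuous_comp _ _ _ (fun u => z - u) (fun y => y ^+ k)).
  by apply: cvgB; [exact: cvg_cst|exact: cvg_id].
exact: exprn_continuous.
Qed.

Lemma Cl1_val z : 0 < `|z| < 1 -> Cl 1 (2 * pi * z) = - ln (2 * sin (pi * `|z|)).
Proof. by move=> /Cl1E; exact: cvg_lim. Qed.

(** The sines vanish at 0, the cosines are 1. *)
Lemma Cl_at0 p : (0 < p)%N -> Cl p.+1 0 = (~~ odd p)%:R * zeta R p.+1.
Proof.
move=> p0; rewrite /Cl /zeta /=; case: (odd p) => /=.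
  rewrite mul0r; apply: cvg_lim => //; under eq_fun => N.
    by under eq_bigr => k _ do rewrite mulr0 sin0 mul0r; rewrite big1_eq; over.
  exact: cvg_cst.
rewrite mul1r; congr (limn _); apply/funext => N; apply: eq_bigr => k _.
by rewrite mulr0 cos0 mul1r.
Qed.

(** Only the term k = p survives, and only when p is even. *)
Lemma clausen_part0 p : (0 < p)%N -> clausen_part p 0 =
  (~~ odd p)%:R * (p`!%:R * (-1) ^+ p./2 * pi / (2 * pi) ^+ p.+1 * zeta R p.+1).
Proof.
move=> p0; rewrite /clausen_part -{1}(prednK p0) big_nat_recr//= big_nat big1 ?add0r; last first.
  move=> k /andP[_ kp]; rewrite expr0n subn_eq0 leqNgt (_ : (k.+1 < p)%N) ?mulr0 ?mul0r//.
  by lia.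
rewrite !prednK// subnn expr0 mulr1 mulr0 Cl_at0// /clausen_coef subnn fact0 mul1r.
case: (boolP (odd p)) => podd /=; first by rewrite !mul0r mulr0.
by rewrite uphalf_half (negbTE podd) !mul1r.
Qed.

End closed_form.

(** * The theorem *)

Theorem mainTheorem9 (R : realType) (p : nat) (z : R)
  (hp : (1 <= p)%N) (hz : 0 < `|z| < 1) :
  (fun N : nat => \sum_(1 <= n < N)
     (zeta R (2 * n + 1) * z ^+ (2 * n)) / (2 * n + p + 1)%:R) @ \oo -->
  - (2 * z * p%:R)^-1 - euler_mascheroni R / (p + 1)%:R
  + \sum_(0 <= k < p.+1)
      (p`!%:R * (-1) ^+ (k.+1)./2 * pi) / ((p - k)`!%:R * (2 * pi * z) ^+ k.+1)
      * Cl k.+1 (2 * pi * z)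
  - (~~ odd p)%:R
      * ((p`!%:R * (-1) ^+ p./2 * pi) / (2 * pi * z) ^+ p.+1 * zeta R p.+1)
  - \sum_(0 <= k < p.+1)
      (p`!%:R * (-1) ^+ k * negapolygamma k.+1 z)
      / ((p - k)`!%:R * z ^+ k.+1).
Proof.
have z0 : z != 0 by case/andP: hz; rewrite normr_gt0.
have f0 n : (n`!%:R : R) != 0 by rewrite pnatr_eq0 -lt0n fact_gt0.
have p0 : (p%:R : R) != 0 by rewrite pnatr_eq0 -lt0n.
have p1 : ((p + 1)%:R : R) != 0 by rewrite addn1.
have P0 := lt0r_neq0 (pi_gt0 R).
pose L := - (euler_mascheroni R * z) + Cl 1 (2 * pi * z) / 2 + ln (2 * pi) / 2
  - ln `|z| / 2 - logGamma z.
have lodd : (@zeta_odd_sum R)^~ z @ \oo --> L.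
  have [a [lo [hi [a01 zlh zP]]]] := punctured_interval hz.
  have [e e0 eP] := logGamma_uniform a01.
  have lG : (@logGamma_partial R)^~ z @ \oo --> logGamma z.
    by apply: (uniform_cvg e0) => N; apply: eP; exact: zP.
  have lC : Cl_partial 1 (2 * pi * z) @ \oo --> Cl 1 (2 * pi * z).
    by rewrite Cl1_val//; exact: Cl1E.
  have -> : (@zeta_odd_sum R)^~ z = (fun N => - (euler_mascheroni R * z)
      + Cl_partial 1 (2 * pi * z) N / 2 + ln (2 * pi) / 2 - ln `|z| / 2
      - logGamma_partial N z).
    by apply/funext => N; rewrite /logGamma_partial; ring.
  apply: cvgB; last exact: lG.
  apply: cvgB; last exact: cvg_cst.
  apply: cvgD; last exact: cvg_cst.
  by apply: cvgD; [exact: cvg_cst|exact: cvgMl].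
have lpart : (@zeta_part_partial R p)^~ z @ \oo --> zeta_part p z.
  have zr : 0 <= `|z| < 1 by case/andP: hz => _ ->; rewrite normr_ge0.
  have [e e0 eP] := zeta_part_uniform hp zr.
  by apply: (uniform_cvg e0) => N; exact: eP.
have -> : (fun N => \sum_(1 <= n < N) (zeta R (2 * n + 1) * z ^+ (2 * n)) / (2 * n + p + 1)%:R) =
    (fun N => (z ^+ p * zeta_odd_sum N z - zeta_part_partial p N z) / z ^+ p.+1).
  apply/funext => N; rewrite /zeta_odd_sum /zeta_part_partial mulr_sumr -sumrB mulr_suml.
  apply: eq_bigr => n _.
  have n1 : ((2 * n + 1)%:R : R) != 0 by rewrite addn1.
  have n2 : ((2 * n + p + 1)%:R : R) != 0 by rewrite addn1.
  have E : (2 * n + p + 1)%:R = (2 * n + 1)%:R + p%:R :> R by rewrite -natrD addnAC.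
  rewrite E in n2 *; have -> : z ^+ (2 * n + p + 1) = z ^+ (2 * n) * z ^+ p.+1.
    by rewrite -exprD addn1 addnS.
  rewrite addn1 in n1 n2 *; rewrite exprSr exprS.
  have zp : z ^+ p != 0 by rewrite expf_neq0.
  move: (zeta R _) => Z; move: (z ^+ p) zp (z ^+ (2 * n)) => X X0 Y.
  move: ((2 * n).+1%:R) n1 n2 => c c0 cp.
  by field; rewrite cp c0 X0 z0.
have l : (fun N => (z ^+ p * zeta_odd_sum N z - zeta_part_partial p N z) / z ^+ p.+1) @ \oo -->
    (z ^+ p * L - zeta_part p z) / z ^+ p.+1.
  by apply: cvgMl; apply: cvgB => //; exact: cvgMr.
have zp1 : z ^+ p.+1 != 0 by rewrite expf_neq0.
have sumC : \sum_(0 <= k < p.+1)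
      (p`!%:R * (-1) ^+ (k.+1)./2 * pi) / ((p - k)`!%:R * (2 * pi * z) ^+ k.+1)
      * Cl k.+1 (2 * pi * z) = Cl 1 (2 * pi * z) / (2 * z) + clausen_part p z / z ^+ p.+1.
  rewrite big_nat_recl// subn0 expr0 expr1 mulr1; congr (_ + _).
    move: (Cl _ _) => C; move: (@pi R) P0 (p`!%:R) (f0 p) => P PP g g0.
    by field; rewrite z0 PP g0.
  rewrite /clausen_part mulr_suml; apply: eq_big_nat => k /andP[_ kp].
  rewrite /clausen_coef exprMn.
  have -> : z ^+ p.+1 = z ^+ (p - k.+1) * z ^+ k.+2 by rewrite -exprD; congr (_ ^+ _); lia.
  have PX : (2 * pi) ^+ k.+2 != 0 :> R by rewrite expf_neq0// mulf_neq0.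
  move: (Cl _ _) => C; move: ((2 * pi) ^+ k.+2) PX => Q Q0.
  have zj : z ^+ k.+2 != 0 by rewrite expf_neq0.
  have zqj : z ^+ (p - k.+1) != 0 by rewrite expf_neq0.
  move: (z ^+ k.+2) zj (z ^+ (p - k.+1)) zqj => X X0 Y Y0.
  move: ((p - k.+1)`!%:R) (f0 (p - k.+1)%N) => g g0.
  by field; rewrite X0 Y0 Q0 g0.
(* the value at 0 of the Clausen terms is the zeta(p+1) term *)
have deltaC : (~~ odd p)%:R
      * ((p`!%:R * (-1) ^+ p./2 * pi) / (2 * pi * z) ^+ p.+1 * zeta R p.+1) =
    clausen_part p 0 / z ^+ p.+1.
  rewrite clausen_part0// exprMn.
  have PX : (2 * pi) ^+ p.+1 != 0 :> R by rewrite expf_neq0// mulf_neq0.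
  move: ((2 * pi) ^+ p.+1) PX (z ^+ p.+1) zp1 => Q Q0 X X0.
  by field; rewrite X0 Q0.
rewrite sumC deltaC negapolygamma_sum//.
(* only the Clausen terms contribute at the lower end of the integral *)
have w0 : @moment_primitive R p 0 = - clausen_part p 0.
  have u0 : @zeta_part R p 0 = 0.
    apply: cvg_lim => //; rewrite (_ : (@zeta_part_partial R p)^~ 0 = cst 0); first exact: cvg_cst.
    by apply/funext => N; rewrite /zeta_part_partial big1// => n _; rewrite expr0n addn_eq0 andbF mulr0.
  have zp0 : 0 ^+ p = 0 :> R by rewrite expr0n gtn_eqF.
  rewrite /moment_primitive u0 exprS zp0; ring.
suff <- : (z ^+ p * L - zeta_part p z) / z ^+ p.+1 =
  - (2 * z * p%:R)^-1 - euler_mascheroni R / (p + 1)%:R +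
  (Cl 1 (2 * pi * z) / (2 * z) + clausen_part p z / z ^+ p.+1) -
  clausen_part p 0 / z ^+ p.+1 -
  (logGamma z / z - (moment_primitive p z - moment_primitive p 0) / z ^+ p.+1) by exact: l.
rewrite w0 /moment_primitive /L addn1 exprS in p1 *.
have zp : z ^+ p != 0 by rewrite expf_neq0.
rewrite -natr1 in p1 *.
move: (z ^+ p) zp => X X0; move: (p%:R) p0 p1 => c c0 c1.
move: (Cl _ _) (logGamma z) (clausen_part p z) (clausen_part p 0) (zeta_part p z).
move: (ln (2 * pi)) (ln `|z|) (euler_mascheroni R) => l2 lz g C G K K0 U.
by field; rewrite c0 c1 X0 z0.
Qed.
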